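(* Let $r\ge2$ be an integer and let $\lambda>0$ satisfy $\lambda<(r-1)^{r-1}/(r-2)^r$ (for $r=2$ the right-hand side is interpreted as $+\infty$). Let $x$ be the unique positive solution of $x=1/(1+\lambda x^{r-1})$. Let $G_r(n)$ be a random $r$-regular graph on $n$ nodes. Then the (random) partition function $Z(\lambda,G_r(n))$ corresponding to independent sets satisfies $$\frac{\log Z(\lambda,G_r(n))}{n}\longrightarrow\log\Big[x^{-\frac r2}(2-x)^{-\frac{r-2}{2}}\Big]$$ with high probability as $n\to\infty$. In particular, when $\lambda=1$ and $r=2,3,4,5$, $\log Z(1,G_r(n))/n$ converges with high probability to $\log c_2,\log c_3,\log c_4,\log c_5$ with $c_2\approx1.618$, $c_3\approx1.545$, $c_4\approx1.494$, $c_5\approx1.453$ respectively, each approximation being accurate to within $10^{-3}$.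
   Context: $G_r(n)$ is chosen uniformly at random from the set of all (simple) $r$-regular graphs on $n$ labelled nodes ($n\to\infty$ along those $n$ for which $rn$ is even). For a finite graph $G$, $\mathcal{I}(G)$ is the set of independent sets of $G$ (including the empty set) and $Z(\lambda,G)=\sum_{I\in\mathcal{I}(G)}\lambda^{|I|}$. ''$X_n\to c$ with high probability'' means that for every $\delta>0$, $\mathbb{P}(|X_n-c|>\delta)\to0$ as $n\to\infty$. *)

(* Defs.v *)
From HB Require Import structures.
From mathcomp Require Export all_boot all_order all_algebra.
From mathcomp Require Export all_classical all_reals all_analysis.

Set Implicit Arguments.
Unset Strict Implicit.
Unset Printing Implicit Defensive.

Export Order.TTheory GRing.Theory Num.Theory.
Export numFieldNormedType.Exports.

Local Open Scope ring_scope.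

(* A simple graph on the vertex type T is given by its edge set
   G : {set {set T}}, each edge being an unordered pair of distinct vertices. *)
Definition simple_graph (T : finType) (G : {set {set T}}) : bool :=
  [forall e in G, #|e| == 2%N].

Definition degree (T : finType) (G : {set {set T}}) (v : T) : nat :=
  #|[pred e in G | v \in e]|.

Definition regular_graph (T : finType) (r : nat) (G : {set {set T}}) : bool :=
  simple_graph G && [forall v, degree G v == r].

Definition independent (T : finType) (G : {set {set T}}) (I : {set T}) : bool :=
  [forall e in G, ~~ (e \subset I)].

Definition partition_function (R : realType) (T : finType) (lambda : R)
    (G : {set {set T}}) : R :=
  \sum_(I : {set T} | independent G I) lambda ^+ #|I|.

(* Probability of the event A for G_r(n), uniform on the r-regular graphs with
   vertex set 'I_n; it is 0 by convention when there is no such graph, which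
   for r * n even only happens when n <= r. *)
Definition random_regular_prob (R : realType) (r n : nat)
    (A : pred {set {set 'I_n}}) : R :=
  #|[pred G : {set {set 'I_n}} | regular_graph r G && A G]|%:R
  / #|[pred G : {set {set 'I_n}} | regular_graph r G]|%:R.

(* X_n(G_r(n)) converges to c with high probability, with n tending to infinity
   along the integers such that r * n is even. *)
Definition cvg_whp (R : realType) (r : nat)
    (X : forall n : nat, {set {set 'I_n}} -> R) (c : R) : Prop :=
  forall delta : R, 0 < delta ->
    (random_regular_prob R r (fun G : {set {set 'I_n}} => delta < `|X n G - c|)
       @[n --> within [set n : nat | ~~ odd (r * n)]%classic \oo]
     --> (0 : R))%classic.

Definition log_partition_density (R : realType) (lambda : R) (n : nat)
    (G : {set {set 'I_n}}) : R :=
  ln (partition_function lambda G) / n%:R.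

Definition critical_activity (R : realType) (r : nat) : \bar R :=
  if r == 2%N then +oo%E
  else ((r%:R - 1) ^+ (r - 1) / (r%:R - 2) ^+ r)%:E.

Definition fixed_point_eq (R : realType) (r : nat) (lambda x : R) : Prop :=
  x = 1 / (1 + lambda * x ^+ (r - 1)).

(* Main.v *)
Require Import Defs.
From mathcomp Require Import fintype finset ring lra zify.

(** Write [r = d + 1] and let [Z_t] be the partition function of the graph at
    activity [t].  Its logarithmic derivative in [t] is the sum over the vertices
    [v] of [P_t(v occupied)/t].  The proof shows that, for all but a negligible
    proportion of vertices, this summand is close to its value on the infinite
    [r]-regular tree, and that the tree value is the derivative of the claimed
    limit.  Integrating from [t = 0], where [Z_0 = 1], to [t = lambda] gives the
    convergence ([log_partition_close]).  The integration is an application of the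
    mean value theorem in the variable [x], the activity being
    [t = (1 - x)/x^r]; as [x] decreases from 1 to the given solution, the activity
    increases from 0 to [lambda].

    Two facts carry the argument.

    Correlation decay.  In any graph the odds that a vertex is occupied are
    [t] times a product over its neighbours of [1/(1 + odds)], where the odds of a
    neighbour are taken in the graph from which the vertex and the previous
    neighbours have been deleted ([hardcore_remove]).  If the graph looks like a
    tree down to depth [k], the odds therefore lie in the [k]-th interval obtained
    by iterating [y |-> t/(1 + y)^d] on [[0, t]]
    ([branching_ratio_bounds]).  This map contracts in the coordinate
    [arcsinh (sqrt y)] by a factor that is below 1 exactly when [t] is below the
    critical activity, uniformly for [t <= lambda] ([contraction_factor],
    [tree_map_contracts]), so the intervals shrink exponentially fast in [k].

    Few short cycles.  A vertex that does not see a tree down to depth [k] is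
    joined by a short path to a short cycle.  Such a path with its cycle can be
    opened by exchanging the closing edge [ab] and another edge [cd] for [ac] and
    [bd].  There are about [rn] choices for [cd], the exchange is injective, and an
    opened configuration is a path with two extra edges, of which a regular graph
    has only [O(n)].  Hence the mean number of short cycles is bounded
    ([switching_bound]), and Markov's inequality concludes
    ([cvg_whp_bethe]). *)

Set Implicit Arguments.
Unset Strict Implicit.
Unset Printing Implicit Defensive.

Local Open Scope ring_scope.

(** * The hard-core model on induced subgraphs *)

Definition adjacent (T : finType) (G : {set {set T}}) : rel T :=
  fun u v => [set u; v] \in G.

Definition neighbours (T : finType) (G : {set {set T}}) (v : T) : {set T} :=
  [set u | adjacent G v u].

Lemma adjacentC (T : finType) (G : {set {set T}}) u v :
  adjacent G u v = adjacent G v u.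
Proof. by rewrite /adjacent finset.setUC. Qed.

Lemma adjacent_irrefl (T : finType) (G : {set {set T}}) v :
  simple_graph G -> adjacent G v v = false.
Proof.
move=> /forall_inP sG; apply/negP => /sG.
by rewrite cards2 eqxx.
Qed.

(** In a simple graph every edge is a pair of distinct vertices, so independence
    can be tested on pairs of vertices through the adjacency relation. *)
Lemma independentP (T : finType) (G : {set {set T}}) (I : {set T}) :
  simple_graph G ->
  reflect (forall u v, u \in I -> v \in I -> ~~ adjacent G u v)
          (independent G I).
Proof.
move=> /forall_inP sG; apply: (iffP forall_inP) => [indI u v uI vI|indI e eG].
  apply/negP => /indI/negP; apply.
  by rewrite finset.subUset !sub1set uI vI.
have /cards2P[u [v [uv def_e]]] := sG _ eG.
apply/negP; rewrite def_e finset.subUset !sub1set => /andP[uI vI].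
by have := indI _ _ uI vI; rewrite /adjacent -def_e eG.
Qed.

(** The partition function of the hard-core model of activity [t] on the subgraph
    induced by [S].  Deleting vertices only changes [S], which keeps all the
    recursions below inside one graph. *)
Definition hardcore (R : realType) (T : finType) (t : R) (G : {set {set T}})
    (S : {set T}) : R :=
  \sum_(I : {set T} | independent G I && (I \subset S)) t ^+ #|I|.

Lemma hardcore_ge1 (R : realType) (T : finType) (t : R) (G : {set {set T}}) S :
  simple_graph G -> 0 <= t -> 1 <= hardcore t G S.
Proof.
move=> sG t0; rewrite /hardcore (bigD1 finset.set0) /=; last first.
  rewrite finset.sub0set andbT; apply/independentP => // u v.
  by rewrite inE.
rewrite cards0 expr0 lerDl; apply: sumr_ge0 => I _; exact: exprn_ge0.
Qed.

Lemma hardcore_gt0 (R : realType) (T : finType) (t : R) (G : {set {set T}}) S :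
  simple_graph G -> 0 <= t -> 0 < hardcore t G S.
Proof. by move=> sG t0; apply: lt_le_trans (hardcore_ge1 S sG t0). Qed.

(** Removing [v] is a bijection between the two families of sets.  The weight is an arbitrary function of the size, since the lemma serves both for
    the partition function and for its derivative. *)
Lemma hardcore_occupied (R : realType) (T : finType) (G : {set {set T}})
    (S : {set T}) (v : T) (f : nat -> R) :
  simple_graph G -> v \in S ->
  \sum_(I : {set T} | independent G I && (I \subset S) && (v \in I)) f #|I| =
  \sum_(J : {set T} | independent G J && (J \subset S :\ v :\: neighbours G v))
     f #|J|.+1.
Proof.
move=> sG vS.
rewrite (reindex_onto (fun J : {set T} => v |: J) (fun I => I :\ v)) /=; last first.
  by move=> I /andP[_ vI]; rewrite setD1K.
have key (J : {set T}) : (v \notin J) && (v |: J \subset S) &&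
   independent G (v |: J) =
   independent G J && (J \subset S :\ v :\: neighbours G v).
  rewrite finset.subsetD subsetD1 finset.subUset sub1set vS /=.
  apply/idP/idP.
    move=> /andP[/andP[vJ JS] /(independentP _ sG) ind].
    rewrite vJ JS /= andbC; apply/andP; split.
      rewrite disjoint_subset; apply/fintype.subsetP => u uJ; rewrite !inE.
      by apply: ind; rewrite !inE ?eqxx ?uJ ?orbT.
    by apply/independentP => // u w uJ wJ; apply: ind; rewrite !inE ?uJ ?wJ orbT.
  move=> /andP[/(independentP _ sG) ind /andP[/andP[JS vJ] dis]].
  rewrite vJ JS /=; apply/independentP => // u w.
  have nadj z : z \in J -> ~~ adjacent G v z.
    move=> zJ; have := disjointFr dis zJ; rewrite inE => ->//.
  rewrite !inE => /orP[/eqP->|uJ] /orP[/eqP->|wJ].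
  - by rewrite adjacent_irrefl.
  - exact: nadj.
  - by rewrite adjacentC; exact: nadj.
  - exact: ind.
apply: eq_big => J.
  rewrite -key setU11 andbT.
  have -> : ((v |: J) :\ v == J) = (v \notin J).
    apply/eqP/idP => [<-|vJ]; first by rewrite !inE eqxx.
    by rewrite setU1K.
  by rewrite andbC [independent _ _ && _]andbC andbA.
move=> /andP[_ /eqP eJ]; congr f.
by rewrite cardsU1 -eJ !inE eqxx eJ.
Qed.

Lemma hardcoreD1 (R : realType) (T : finType) (t : R) (G : {set {set T}})
    (S : {set T}) (v : T) :
  simple_graph G -> v \in S ->
  hardcore t G S =
  hardcore t G (S :\ v) + t * hardcore t G (S :\ v :\: neighbours G v).
Proof.
move=> sG vS; rewrite {1}/hardcore (bigID (fun I : {set T} => v \in I)) /= addrC.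
congr (_ + _).
  by apply: eq_bigl => I; rewrite subsetD1 andbA.
rewrite (hardcore_occupied (fun m => t ^+ m) sG vS) /hardcore mulr_sumr.
by apply: eq_bigr => J _; rewrite exprS.
Qed.

(** The odds P(v occupied) / P(v vacant) in the hard-core model on [S]. *)
Definition occupation_ratio (R : realType) (T : finType) (t : R)
    (G : {set {set T}}) (S : {set T}) (v : T) : R :=
  t * hardcore t G (S :\ v :\: neighbours G v) / hardcore t G (S :\ v).

Lemma occupation_ratio_ge0 (R : realType) (T : finType) (t : R)
    (G : {set {set T}}) (S : {set T}) (v : T) :
  simple_graph G -> 0 <= t -> 0 <= occupation_ratio t G S v.
Proof.
by move=> sG t0; rewrite divr_ge0 ?mulr_ge0 //; apply/ltW/hardcore_gt0.
Qed.

Lemma hardcore_ratio (R : realType) (T : finType) (t : R) (G : {set {set T}})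
    (S : {set T}) (v : T) :
  simple_graph G -> 0 <= t -> v \in S ->
  hardcore t G S = hardcore t G (S :\ v) * (1 + occupation_ratio t G S v).
Proof.
move=> sG t0 vS; rewrite (hardcoreD1 t sG vS) mulrDr mulr1; congr (_ + _).
by rewrite /occupation_ratio mulrCA divff ?mulr1 // gt_eqF // hardcore_gt0.
Qed.

(** Deleting the vertices of [W] one at a time divides the partition function by
    a factor [1 + occupation_ratio] at each step.  It is enough to bound the ratio
    in each of the intermediate graphs.  As the graph shrinks from one factor to the next, the product
    formula is exact even when the neighbourhood contains cycles. *)
Lemma hardcore_remove (R : realType) (T : finType) (t lo hi : R)
    (G : {set {set T}}) (S W : {set T}) :
  simple_graph G -> 0 <= t -> 0 <= lo -> 0 <= hi -> W \subset S ->
  (forall (W' : {set T}) (u : T), W' \subset W -> u \in W :\: W' ->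
     lo <= occupation_ratio t G (S :\: W') u <= hi) ->
  hardcore t G (S :\: W) * (1 + lo) ^+ #|W| <= hardcore t G S
    <= hardcore t G (S :\: W) * (1 + hi) ^+ #|W|.
Proof.
move=> sG t0 lo0 hi0; move: {2}#|W| (erefl #|W|) => n; elim: n W => [|n IHn] W.
  move=> /cards0_eq -> _ _.
  by rewrite cards0 finset.setD0 !expr0 !mulr1 lexx.
move=> cW WS bnd.
have [u uW] : exists u, u \in W by apply/set0Pn; rewrite -cards_eq0 cW.
have cW' : #|W :\ u| = n by apply: succn_inj; rewrite -cW (cardsD1 u W) uW.
have /andP[l1 u1] : hardcore t G (S :\: (W :\ u)) * (1 + lo) ^+ #|W :\ u|
    <= hardcore t G S <= hardcore t G (S :\: (W :\ u)) * (1 + hi) ^+ #|W :\ u|.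
  apply: IHn => //; first by apply: subset_trans WS; exact: subsetDl.
  move=> W' w sW' wW'; apply: bnd.
    by apply: subset_trans sW' _; exact: subsetDl.
  by apply: subsetP wW'; apply: finset.setSD; exact: subsetDl.
have uS : u \in S :\: (W :\ u) by rewrite !inE eqxx /= (fintype.subsetP WS).
have /andP[l2 u2] : lo <= occupation_ratio t G (S :\: (W :\ u)) u <= hi.
  by apply: bnd; rewrite ?subsetDl // !inE eqxx uW.
have e : S :\: (W :\ u) :\ u = S :\: W.
  by apply/setP => z; rewrite !inE; case: (eqVneq z u) => [->|] /=; rewrite ?uW.
have r1 := hardcore_ratio sG t0 uS; rewrite e in r1.
have Z0 := ltW (hardcore_gt0 (S :\: W) sG t0).
rewrite cW !exprS !mulrA -cW'; apply/andP; split.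
  apply: le_trans l1; rewrite r1 ler_wpM2r ?exprn_ge0 ?addr_ge0 //.
  by rewrite ler_wpM2l // lerD2l.
apply: le_trans u1 _; rewrite r1 ler_wpM2r ?exprn_ge0 ?addr_ge0 //.
by rewrite ler_wpM2l // lerD2l.
Qed.

(** * Occupation ratios on tree-like neighbourhoods *)

(** Exactly what the recursion for [occupation_ratio] requires of the graph down
    to depth [k].  Every vertex reached has [d] surviving neighbours, whichever of
    its siblings have been deleted before it.  The sets [W] are the siblings
    deleted so far. *)
Fixpoint branching (T : finType) (G : {set {set T}}) (d k : nat)
    (S : {set T}) (v : T) : Prop :=
  if k is k'.+1 then
    #|neighbours G v :&: S| = d /\
    forall (W : {set T}) (u : T), W \subset neighbours G v :&: S ->
      u \in (neighbours G v :&: S) :\: W -> branching G d k' (S :\ v :\: W) u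
  else True.

(** The recursion for the occupation ratio on the tree where each vertex has [d]
    children: all children having ratio [y], the parent has ratio [t/(1+y)^d]. *)
Definition tree_map (R : realType) (d : nat) (t y : R) : R :=
  t / (1 + y) ^+ d.

(** The recursion is decreasing in the ratios of the children, hence lower bounds
    become upper bounds and conversely.  The starting interval [[0, t]] contains
    the occupation ratio of any vertex of any graph. *)
Fixpoint tree_bounds (R : realType) (d : nat) (t : R) (k : nat) : R * R :=
  if k is k'.+1 then
    (tree_map d t (tree_bounds d t k').2, tree_map d t (tree_bounds d t k').1)
  else (0, t).

Lemma tree_bounds_ge0 (R : realType) (d : nat) (t : R) (k : nat) :
  0 <= t -> 0 <= (tree_bounds d t k).1 /\ 0 <= (tree_bounds d t k).2.
Proof.
move=> t0; elim: k => [|k [l u]] //=.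
by split; rewrite divr_ge0 // exprn_ge0 // addr_ge0.
Qed.

(** The quotient is the probability that all the neighbours of [v] are vacant once
    [v] is deleted: a product of factors [1 / (1 + occupation_ratio)], one for each
    neighbour. *)
Lemma hardcore_remove_neighbours (R : realType) (T : finType) (t lo hi : R)
    (G : {set {set T}}) (S : {set T}) (v : T) :
  simple_graph G -> 0 <= t -> 0 <= lo -> 0 <= hi ->
  (forall (W : {set T}) (u : T), W \subset neighbours G v :&: S ->
     u \in (neighbours G v :&: S) :\: W ->
     lo <= occupation_ratio t G (S :\ v :\: W) u <= hi) ->
  ((1 + hi) ^+ #|neighbours G v :&: S|)^-1
    <= hardcore t G (S :\ v :\: neighbours G v) / hardcore t G (S :\ v)
    <= ((1 + lo) ^+ #|neighbours G v :&: S|)^-1.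
Proof.
move=> sG t0 lo0 hi0 bnd; set m := #|_|.
have sN : neighbours G v :&: S \subset S :\ v.
  apply/fintype.subsetP => u; rewrite !inE => /andP[avu ->]; rewrite andbT.
  by apply: contraTneq avu => ->; rewrite adjacent_irrefl.
have := hardcore_remove sG t0 lo0 hi0 sN bnd.
have -> : S :\ v :\: (neighbours G v :&: S) = S :\ v :\: neighbours G v.
  by apply/setP => z; rewrite !inE; case: (z \in S); rewrite ?andbT ?andbF.
rewrite -/m => /andP[l1 u1].
have Z0 := hardcore_gt0 (S :\ v) sG t0.
have p0 x : 0 <= x -> 0 < (1 + x) ^+ m by move=> x0; rewrite exprn_gt0 ?ltr_wpDr.
rewrite ler_pdivlMr // ler_pdivrMr // mulrC ler_pdivrMr ?p0 //.
by rewrite [X in _ && (_ <= X)]mulrC ler_pdivlMr ?p0 // l1 u1.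
Qed.

Lemma occupation_ratio_le (R : realType) (T : finType) (t : R)
    (G : {set {set T}}) (S : {set T}) (v : T) :
  simple_graph G -> 0 <= t -> occupation_ratio t G S v <= t.
Proof.
move=> sG t0; rewrite /occupation_ratio -mulrA ler_piMr //.
rewrite ler_pdivrMr ?hardcore_gt0 // mul1r /hardcore [leRHS](bigID (fun I : {set T} =>
  I \subset S :\ v :\: neighbours G v)) /= ler_wpDr //.
  by apply: sumr_ge0 => I _; exact: exprn_ge0.
rewrite le_eqVlt; apply/orP; left; apply/eqP; apply: eq_bigl => I.
rewrite -andbA; congr (_ && _); apply/idP/andP => [h|[] //]; split => //.
by apply: fintype.subset_trans h _; exact: subsetDl.
Qed.

(** Induction on [k]: the recursion maps an interval that contains the ratios of
    the children to the next interval of [tree_bounds]. *)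
Lemma branching_ratio_bounds (R : realType) (T : finType) (t : R)
    (G : {set {set T}}) (d k : nat) (S : {set T}) (v : T) :
  simple_graph G -> 0 <= t -> branching G d k S v ->
  (tree_bounds d t k).1 <= occupation_ratio t G S v <= (tree_bounds d t k).2.
Proof.
move=> sG t0; elim: k S v => [|k IHk] S v /=.
  by move=> _; rewrite occupation_ratio_ge0 ?occupation_ratio_le.
move=> [cN br].
have [lo0 hi0] := tree_bounds_ge0 d k t0.
have := hardcore_remove_neighbours sG t0 lo0 hi0
  (fun W u sW uW => IHk _ _ (br W u sW uW)).
rewrite /= cN /occupation_ratio /tree_map -mulrA => /andP[l u].
by rewrite !ler_wpM2l.
Qed.

(** * Contraction of the tree recursion below the critical activity *)

(** The inequality between the arithmetic and geometric means of [u^(n+1)] with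
    weight 1 and [D^(n+1)] with weight [n].  Each induction step uses that [u - D]
    and [u^(n+1) - D^(n+1)] have the same sign. *)
Lemma weighted_AMGM (R : realType) (n : nat) (u D : R) : 0 <= u -> 0 <= D ->
  n.+1%:R * u * D ^+ n <= u ^+ n.+1 + n%:R * D ^+ n.+1.
Proof.
move=> u0 D0; elim: n => [|n IHn]; first by rewrite !expr1 expr0 mul0r addr0 mulr1 mul1r.
have h : 0 <= (u - D) * (u ^+ n.+1 - D ^+ n.+1).
  have [le|lt] := leP D u.
    by rewrite mulr_ge0 ?subr_ge0 // lerXn2r.
  have lt' := ltW lt.
  by rewrite mulr_le0 ?subr_le0 // lerXn2r.
have : n.+1%:R * u * D ^+ n * D <= (u ^+ n.+1 + n%:R * D ^+ n.+1) * D.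
  exact: ler_wpM2r.
rewrite !exprS in h *; rewrite -!natr1; set a := u ^+ n in h *; set b := D ^+ n in h *.
move=> h2.
have e1 : 0 <= u * a * u + b * D * D - D * u * a - u * D * b by lra.
lra.
Qed.

(** This is where the critical activity [d^d/(d-1)^(d+1)] comes from.  For
    [d >= 2] the maximum over [x >= 0] of [((d^2-1)x - 1)/(1+x)^(d+1)] is its
    inverse, attained at [x = 1/(d-1)]; the bound is [weighted_AMGM] for
    [u = (d-1)(1+x)] and [D = d].  The witness [theta] is the ratio of [lambda] to
    the critical activity; for [d = 1], where the latter is infinite, the formula
    gives 0. *)
Lemma subcritical_factor (R : realType) (d : nat) (lambda : R) :
  (0 < d)%N -> 0 < lambda ->
  (lambda%:E < critical_activity R d.+1)%E ->
  exists2 theta : R, 0 <= theta < 1 &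
    forall t x : R, 0 <= t <= lambda -> 0 <= x ->
      t * ((d%:R ^+ 2 - 1) * x - 1) <= theta * (1 + x) ^+ d.+1.
Proof.
move=> d0 l0 crit.
have D0 : 0 < d%:R :> R by rewrite ltr0n.
have D1 : 0 <= d%:R - 1 :> R by rewrite subr_ge0 ler1n.
have dd0 : 0 < d%:R ^+ d :> R by rewrite exprn_gt0.
exists (lambda * (d%:R - 1) ^+ d.+1 / d%:R ^+ d).
  rewrite divr_ge0 ?mulr_ge0 ?exprn_ge0 ?(ltW l0) ?(ltW D0) //=.
  rewrite ltr_pdivrMr // mul1r.
  move: crit; rewrite /critical_activity; case: eqP => [[d1]|dn1].
    by rewrite d1 subrr exprS mul0r mulr0 expr1n.
  rewrite lte_fin subn1 /=.
  have -> : d.+1%:R - 1 = d%:R :> R by rewrite -natr1; lra.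
  have -> : d.+1%:R - 2 = d%:R - 1 :> R by rewrite -natr1; lra.
  rewrite ltr_pdivlMr ?exprn_gt0 // subr_gt0 ltr1n ltn_neqAle d0 andbT.
  by apply/eqP => d1; apply: dn1; rewrite -d1.
move=> t x /andP[t0 tl] x0.
have amgm : d%:R ^+ d * ((d%:R ^+ 2 - 1) * x - 1) <= ((d%:R - 1) * (1 + x)) ^+ d.+1.
  have q0 : 0 <= (d%:R - 1) * (1 + x) :> R by rewrite mulr_ge0 // addr_ge0.
  have := weighted_AMGM d q0 (ltW D0).
  set q := (d%:R - 1) * (1 + x).
  rewrite [d%:R ^+ d.+1]exprS -natr1; set P := d%:R ^+ d => h.
  suff : (d%:R + 1) * q * P - d%:R * (d%:R * P) = P * ((d%:R ^+ 2 - 1) * x - 1) by lra.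
  by rewrite /q; ring.
rewrite exprMn in amgm.
rewrite mulrAC ler_pdivlMr // -!mulrA.
have y0 : 0 <= (d%:R - 1) ^+ d.+1 * (1 + x) ^+ d.+1 :> R.
  by rewrite mulr_ge0 // exprn_ge0 // addr_ge0.
apply: (@le_trans _ _ (t * ((d%:R - 1) ^+ d.+1 * (1 + x) ^+ d.+1))).
  by rewrite ler_wpM2l // mulrC.
by rewrite ler_wpM2r.
Qed.

(** The inequality says that the derivative of [tree_map d t], measured in
    [contraction_coordinate], is at most [alpha] in absolute value.  The same
    [alpha] works for all activities up to [lambda]: this uniformity is needed to
    integrate over the activity. *)
Lemma contraction_factor (R : realType) (d : nat) (lambda : R) :
  (0 < d)%N -> 0 < lambda ->
  (lambda%:E < critical_activity R d.+1)%E ->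
  exists2 alpha : R, 0 <= alpha < 1 &
    forall t x : R, 0 <= t <= lambda -> 0 <= x ->
      d%:R ^+ 2 * x * t <= alpha ^+ 2 * ((1 + x) * ((1 + x) ^+ d + t)).
Proof.
move=> d0 l0 crit.
have [theta /andP[th0 th1] H] := subcritical_factor d0 l0 crit.
have a2 : 0 <= 1 - (1 - theta) / (1 + lambda) < 1.
  have l1 : 0 < 1 + lambda by lra.
  have th2 : 0 < 1 - theta by lra.
  rewrite subr_ge0 ler_pdivrMr // gtrDl oppr_lt0 divr_gt0 // andbT.
  lra.
exists (Num.sqrt (1 - (1 - theta) / (1 + lambda))).
  by rewrite sqrtr_ge0 -[ltRHS]sqrtr1 ltr_sqrt // (andP a2).2.
move=> t x tl x0; rewrite sqr_sqrtr ?(andP a2).1 //.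
have := H t x tl x0; rewrite [(1 + x) ^+ _.+1]exprS.
move: tl => /andP[t0 tl].
have A1 : 1 <= (1 + x) ^+ d by rewrite exprn_ege1 // lerDl.
set A := _ ^+ d in A1 *; move=> {}H.
apply: (@le_trans _ _ ((1 + x) * (theta * A + t))).
  by lra.
rewrite mulrCA ler_wpM2l ?addr_ge0 //.
(* As [1 <= A] and [t <= lambda], [A] is at least [(A + t)/(1 + lambda)]; this is
   what the choice of [alpha] requires. *)
suff : (1 - theta) / (1 + lambda) * (A + t) <= (1 - theta) * A by lra.
rewrite mulrAC ler_pdivrMr; last lra.
rewrite -mulrA ler_wpM2l ?subr_ge0 ?(ltW th1) //.
have : lambda <= A * lambda by rewrite ler_peMl // ltW.
lra.
Qed.

(** Half of the primitive of [1/sqrt(x(1+x))], that is, [arcsinh (sqrt x)].  In the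
    plain coordinate [tree_map] need not contract; in this one it does for every
    subcritical activity. *)
Definition contraction_coordinate (R : realType) (x : R) : R :=
  ln (Num.sqrt x + Num.sqrt (1 + x)).

Lemma is_derive_contraction_coordinate (R : realType) (x : R) : 0 < x ->
  is_derive x 1 (@contraction_coordinate R) (2 * Num.sqrt (x * (1 + x)))^-1.
Proof.
move=> x0.
have x1 : 0 < 1 + x by rewrite addr_gt0.
have s0 : 0 < Num.sqrt x by rewrite sqrtr_gt0.
have s1 : 0 < Num.sqrt (1 + x) by rewrite sqrtr_gt0.
have d0 := is_derive1_sqrt x0.
have d1' : is_derive x 1 (fun y : R => 1 + y) 1.
  have := is_deriveD (is_derive_cst (1 : R) x (1 : R)) (is_derive_id x (1 : R)).
  by rewrite add0r.
have d1 := is_derive1_comp (is_derive1_sqrt x1) d1'.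
have d2 := is_deriveD d0 d1.
have sp : 0 < (Num.sqrt + (Num.sqrt \o (fun y : R => 1 + y))) x.
  by rewrite /= addr_gt0.
have d3 := is_derive1_comp (is_derive1_ln sp) d2.
apply: (is_derive_eq d3).
rewrite /= mulr1 sqrtrM ?(ltW x0) //.
rewrite !fctE /=.
field.
by rewrite !gt_eqF // addr_gt0.
Qed.

Lemma contraction_coordinate_continuous (R : realType) (x : R) :
  0 <= x -> continuous_at x (@contraction_coordinate R).
Proof.
move=> x0.
have cs : continuous_at x (fun y : R => Num.sqrt y + Num.sqrt (1 + y)).
  apply: cvgD; first exact: sqrt_continuous.
  apply: continuous_comp; last exact: sqrt_continuous.
  by apply: cvgD; [exact: cvg_cst|exact: cvg_id].
apply: (continuous_comp cs).
by apply: continuous_ln; rewrite ltr_wpDl ?sqrtr_ge0 ?sqrtr_gt0 // ltr_pwDl.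
Qed.

(** The derivative is only asked for at positive points, because the square roots
    in [contraction_coordinate] are not differentiable at 0. *)
Lemma ndecr_of_is_derive_ge0 (R : realType) (g dg : R -> R) (a b : R) :
  (forall x : R, 0 <= x -> continuous_at x g) ->
  (forall x : R, 0 < x -> is_derive x 1 g (dg x)) ->
  (forall x : R, 0 < x <= b -> 0 <= dg x) ->
  0 <= a <= b -> g a <= g b.
Proof.
move=> cg dgP dg0 /andP[a0 ab].
apply: (@ger0_derive1_ndecr R g a b) => //.
- move=> x /[!in_itv]/= /andP[ax _].
  by apply: ex_derive; apply: dgP; exact: le_lt_trans ax.
- move=> x /[!in_itv]/= /andP[ax xb].
  have x0 := le_lt_trans a0 ax.
  by rewrite derive1E (@derive_val _ _ _ _ _ _ _ (dgP x x0)) dg0 // x0 ltW.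
- apply: continuous_in_subspaceT => x /set_mem /=.
  by rewrite in_itv /= => /andP[ax _]; apply: cg; exact: le_trans ax.
Qed.

Lemma is_derive_tree_map (R : realType) (d : nat) (t x : R) : 0 <= x ->
  is_derive x 1 (tree_map d t) (- (d%:R * tree_map d t x / (1 + x))).
Proof.
move=> x0; have x1 : 0 < 1 + x by rewrite ltr_pwDl.
have d1 : is_derive x 1 (fun y : R => 1 + y) 1.
  have := is_deriveD (is_derive_cst (1 : R) x (1 : R)) (is_derive_id x (1 : R)).
  by rewrite add0r.
have d2 := is_deriveX d d1.
have nz : ((fun y : R => 1 + y) ^+ d) x != 0.
  by rewrite fctE expf_neq0 // gt_eqF.
have d3 := is_deriveZ t (is_deriveV nz d2).
have -> : tree_map d t =
    t \*: (fun y : R => (((fun z : R => 1 + z) ^+ d) y)^-1).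
  by apply/funext => y; rewrite /tree_map !fctE.
apply: (is_derive_eq d3).
rewrite !fctE /tree_map /= /GRing.scale /=.
case: d {d2 nz d3} => [|d]; first by rewrite !mul0r mulr0 oppr0 mulr0.
rewrite /= !exprS; field.
by rewrite gt_eqF // expf_neq0 // gt_eqF.
Qed.

(** Equivalently [alpha * psi + psi \o tree_map d t] is nondecreasing, where [psi]
    is [contraction_coordinate].  After clearing denominators and squaring, the
    sign of its derivative is the hypothesis. *)
Lemma tree_map_contracts (R : realType) (d : nat) (t alpha x y : R) :
  0 < t -> 0 <= alpha ->
  (forall z : R, 0 <= z ->
     d%:R ^+ 2 * z * t <= alpha ^+ 2 * ((1 + z) * ((1 + z) ^+ d + t))) ->
  0 <= x <= y ->
  contraction_coordinate (tree_map d t x) - contraction_coordinate (tree_map d t y)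
    <= alpha * (contraction_coordinate y - contraction_coordinate x).
Proof.
move=> t0 a0 H xy.
have Fpos z : 0 <= z -> 0 < tree_map d t z.
  by move=> z0; rewrite divr_gt0 // exprn_gt0 // ltr_pwDl.
pose g z := alpha * contraction_coordinate z + contraction_coordinate (tree_map d t z).
suff : g x <= g y by rewrite /g; lra.
apply: (ndecr_of_is_derive_ge0 (dg := fun z => alpha * (2 * Num.sqrt (z * (1 + z)))^-1 +
   (2 * Num.sqrt (tree_map d t z * (1 + tree_map d t z)))^-1
     * - (d%:R * tree_map d t z / (1 + z)))) => //.
- move=> z z0; apply: cvgD.
    by apply: cvgM; [exact: cvg_cst|exact: contraction_coordinate_continuous].
  apply: continuous_comp; last first.
    by apply: contraction_coordinate_continuous; exact/ltW/Fpos.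
  apply: differentiable_continuous; apply/derivable1_diffP.
  have h := is_derive_tree_map d t z0.
  exact: (@ex_derive _ _ _ _ _ _ _ h).
- move=> z z0; apply: is_deriveD.
    exact: (is_deriveZ alpha (is_derive_contraction_coordinate z0)).
  have d1 := is_derive_tree_map d t (ltW z0).
  exact: (is_derive1_comp (is_derive_contraction_coordinate (Fpos _ (ltW z0))) d1).
move=> z /andP[z0 _].
have := Fpos _ (ltW z0); move FE : (tree_map d t z) => F F0.
have z1 : 0 < 1 + z by rewrite ltr_pwDl // ltW.
have F1 : 0 < 1 + F by rewrite ltr_pwDl // ltW.
set A := Num.sqrt (z * (1 + z)); set B := Num.sqrt (F * (1 + F)).
have A0 : 0 < A by rewrite sqrtr_gt0 mulr_gt0.
have B0 : 0 < B by rewrite sqrtr_gt0 mulr_gt0.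
have key : d%:R * F * A <= alpha * (1 + z) * B.
  rewrite -(@ler_pXn2r _ 2) ?nnegrE ?mulr_ge0 ?ler0n ?(ltW F0) ?(ltW A0) ?(ltW B0) ?(ltW z1) //.
  have A2 : A ^+ 2 = z * (1 + z) by rewrite sqr_sqrtr // mulr_ge0 // ltW.
  have B2 : B ^+ 2 = F * (1 + F) by rewrite sqr_sqrtr // mulr_ge0 // ltW.
  have -> : (d%:R * F * A) ^+ 2 = d%:R ^+ 2 * F ^+ 2 * A ^+ 2 by ring.
  have -> : (alpha * (1 + z) * B) ^+ 2 = alpha ^+ 2 * (1 + z) ^+ 2 * B ^+ 2 by ring.
  rewrite A2 B2.
  have P0 : 0 < (1 + z) ^+ d by rewrite exprn_gt0.
  have h := H z (ltW z0).
  have -> : d%:R ^+ 2 * F ^+ 2 * (z * (1 + z)) =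
    (d%:R ^+ 2 * z * t) * (F * (1 + z) / (1 + z) ^+ d).
    by rewrite -FE /tree_map; field; rewrite gt_eqF.
  have -> : alpha ^+ 2 * (1 + z) ^+ 2 * (F * (1 + F)) =
     alpha ^+ 2 * ((1 + z) * ((1 + z) ^+ d + t)) * (F * (1 + z) / (1 + z) ^+ d).
    by rewrite -FE /tree_map; field; rewrite gt_eqF.
  by apply: ler_wpM2r h; apply: divr_ge0; [apply: mulr_ge0|]; exact: ltW.
rewrite mulrN subr_ge0 ler_pdivrMl ?mulr_gt0 //.
rewrite ler_pdivrMr //.
have -> : 2 * B * (alpha * (2 * A)^-1) * (1 + z) = alpha * (1 + z) * B / A.
  by field; rewrite gt_eqF.
by rewrite ler_pdivlMr.
Qed.

Lemma tree_bounds_le (R : realType) (d : nat) (t : R) (k : nat) :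
  0 <= t ->
  [/\ 0 <= (tree_bounds d t k).1, (tree_bounds d t k).1 <= (tree_bounds d t k).2
    & (tree_bounds d t k).2 <= t].
Proof.
move=> t0; elim: k => [|k]; first by split.
case E : (tree_bounds d t k) => [l u] /=; rewrite E /= => -[l0 lu ut].
have u0 := le_trans l0 lu.
have p0 z : 0 <= z -> 0 < (1 + z) ^+ d by move=> z0; rewrite exprn_gt0 // ltr_pwDl.
split.
- by rewrite divr_ge0 // ltW // p0.
- rewrite /tree_map ler_wpM2l // lef_pV2 ?posrE ?p0 //.
  by rewrite lerXn2r ?nnegrE ?addr_ge0 // lerD2l.
- by rewrite ler_pdivrMr ?p0 // ler_peMr // exprn_ege1 // lerDl.
Qed.

(** The intervals shrink around any fixed point, since the recursion is
    decreasing and maps it to itself. *)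
Lemma tree_bounds_fixed_point (R : realType) (d : nat) (t rho : R) (k : nat) :
  0 <= t -> 0 <= rho -> tree_map d t rho = rho ->
  (tree_bounds d t k).1 <= rho <= (tree_bounds d t k).2.
Proof.
move=> t0 rho0 fix_rho.
have p0 z : 0 <= z -> 0 < (1 + z) ^+ d by move=> z0; rewrite exprn_gt0 // ltr_pwDl.
elim: k => [|k] /=.
  rewrite rho0 -fix_rho /tree_map ler_pdivrMr ?p0 //.
  by rewrite ler_peMr // exprn_ege1 // lerDl.
have [] := tree_bounds_le d k t0.
case: (tree_bounds d t k) => [l u] /= l0 lu _ /andP[lr ru].
have u0 := le_trans l0 lu.
by rewrite -{1 2}fix_rho /tree_map; apply/andP; split; rewrite ler_wpM2l //;
  rewrite lef_pV2 ?posrE ?p0 // lerXn2r ?nnegrE ?addr_ge0 // lerD2l.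
Qed.

Lemma contraction_coordinate_homo (R : realType) (x y : R) : 0 <= x <= y ->
  contraction_coordinate x <= contraction_coordinate y.
Proof.
move=> xy; apply: (ndecr_of_is_derive_ge0 (dg := fun z => (2 * Num.sqrt (z * (1 + z)))^-1)) => //.
- exact: contraction_coordinate_continuous.
- exact: is_derive_contraction_coordinate.
Qed.

(** Converts a small gap in the contraction coordinate to a small gap between the
    ratios; the derivative of the coordinate is at least [1/(2(1+b))] on [[0, b]]. *)
Lemma contraction_coordinate_expands (R : realType) (b x y : R) : 0 <= x <= y -> y <= b ->
  y - x <= 2 * (1 + b) * (contraction_coordinate y - contraction_coordinate x).
Proof.
move=> xy yb.
pose g z := 2 * (1 + b) * contraction_coordinate z - z.
suff : g x <= g y by rewrite /g; lra.
apply: (ndecr_of_is_derive_ge0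
  (dg := fun z => 2 * (1 + b) * (2 * Num.sqrt (z * (1 + z)))^-1 - 1)); last exact: xy.
- move=> z z0; apply: cvgB; last exact: cvg_id.
  by apply: cvgM; [exact: cvg_cst|exact: contraction_coordinate_continuous].
- move=> z z0; apply: is_deriveB.
  exact: (is_deriveZ _ (is_derive_contraction_coordinate z0)).
move=> z /andP[z0 zy]; have z1 : 0 < 1 + z by rewrite ltr_pwDl // ltW.
have s0 : 0 < Num.sqrt (z * (1 + z)) by rewrite sqrtr_gt0 mulr_gt0.
rewrite subr_ge0 ler_pdivlMr ?mulr_gt0 // mul1r ler_wpM2l //.
have zb : 1 + z <= 1 + b by lra.
apply: le_trans zb; rewrite -[leRHS]ger0_norm ?(ltW z1) // -sqrtr_sqr.
by rewrite ler_sqrt ?exprn_ge0 ?(ltW z1) // expr2 ler_pM2r // lerDr.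
Qed.

(** Correlation decay: what lies at depth [k] changes the ratio at the root by an
    amount exponentially small in [k], uniformly in the activity. *)
Lemma tree_bounds_gap (R : realType) (d : nat) (t lambda alpha : R) (k : nat) :
  0 < t <= lambda -> 0 <= alpha ->
  (forall z : R, 0 <= z ->
     d%:R ^+ 2 * z * t <= alpha ^+ 2 * ((1 + z) * ((1 + z) ^+ d + t))) ->
  (tree_bounds d t k).2 - (tree_bounds d t k).1 <=
    2 * (1 + lambda) * contraction_coordinate lambda * alpha ^+ k.
Proof.
move=> /andP[t0 tl] a0 H.
have l0 : 0 <= lambda by apply: le_trans tl; exact: ltW.
have Psi0 : contraction_coordinate (0 : R) = 0.
  by rewrite /contraction_coordinate addr0 sqrtr0 sqrtr1 add0r ln1.
have psi_l : contraction_coordinate t <= contraction_coordinate lambda.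
  by apply: contraction_coordinate_homo; rewrite ltW.
have gap : contraction_coordinate (tree_bounds d t k).2
    - contraction_coordinate (tree_bounds d t k).1
    <= contraction_coordinate lambda * alpha ^+ k.
  elim: k => [|k IHk] /=; first by rewrite Psi0 subr0 expr0 mulr1.
  have [l0' lu _] := tree_bounds_le d k (ltW t0).
  have lu' : 0 <= (tree_bounds d t k).1 <= (tree_bounds d t k).2 by rewrite l0' lu.
  apply: le_trans (tree_map_contracts t0 a0 H lu') _.
  by rewrite exprS mulrCA ler_wpM2l.
have [l0' lu ut] := tree_bounds_le d k (ltW t0).
have lu' : 0 <= (tree_bounds d t k).1 <= (tree_bounds d t k).2 by rewrite l0' lu.
apply: le_trans (contraction_coordinate_expands lu' (le_trans ut tl)) _.
by rewrite -[leRHS]mulrA ler_wpM2l // mulr_ge0 // addr_ge0.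
Qed.

(** * Short cycles as obstructions to a tree-like neighbourhood *)

Lemma sum_nat_of_bool (T : finType) (P : pred T) :
  (\sum_(x : T) (P x : nat))%N = #|P|.
Proof.
by rewrite -sum1_card [RHS]big_mkcond; apply: eq_bigr => x _; rewrite unfold_in; case: (P x).
Qed.

Lemma degreeE (T : finType) (G : {set {set T}}) (v : T) :
  degree G v = (\sum_(e in G) (v \in e : nat))%N.
Proof.
rewrite /degree -sum1_card big_mkcond [RHS]big_mkcond /=.
apply: eq_bigr => e _; rewrite unfold_in /=.
by case: (e \in G); case: (v \in e).
Qed.

(** Sending a neighbour to the edge that joins it to [v] is a bijection. *)
Lemma card_neighbours (T : finType) (G : {set {set T}}) (v : T) :
  simple_graph G -> #|neighbours G v| = degree G v.
Proof.
move=> sG; rewrite /degree.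
have inj : {in neighbours G v &, injective (fun u => [set v; u])}.
  move=> u w; rewrite !inE => avu avw e.
  have : u \in [set v; w] by rewrite -e !inE eqxx orbT.
  rewrite !inE => /orP[/eqP uv|/eqP //].
  by rewrite uv adjacent_irrefl in avu.
rewrite -(card_in_imset inj); apply: eq_card => e; rewrite [RHS]unfold_in.
apply/imsetP/andP => [[u avu ->]|[eG ve]].
  by move: avu; rewrite !inE eqxx.
have /cards2P[x [y [xy def_e]]] := forall_inP sG _ eG.
move: ve; rewrite def_e !inE => /orP[/eqP vx|/eqP vy].
  by exists y; rewrite ?inE /adjacent vx -?def_e.
by exists x; rewrite ?inE /adjacent vy finset.setUC -?def_e.
Qed.

(** A path [a :: q] without repetition, whose first vertex [a] is also joined to
    [b], a vertex of the path other than [a] and its successor: a cycle through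
    [a] and [b] followed by a tail.  The last vertex of [q] is the vertex from
    which the cycle is seen. *)
Definition lollipop (T : finType) (G : {set {set T}}) (a : T) (q : seq T)
    (b : T) : bool :=
  [&& path (adjacent G) a q, uniq (a :: q), b \in behead q & adjacent G a b].

(** The sequence [v :: q] is the path from the root to [v], in reverse order.  A
    deleted vertex is either on this path or the neighbour of a vertex of the
    path.  If some neighbour of [v] other than its parent has been deleted, then in
    the first case [v :: q] closes up to a lollipop, and in the second case the
    path extended by this neighbour does.  Hence exactly the parent is missing
    among the [d.+1] neighbours of [v]. *)
Lemma branching_of_no_lollipop (T : finType) (G : {set {set T}}) (d k : nat)
    (S : {set T}) (v : T) (q : seq T) :
  simple_graph G -> (forall u, #|neighbours G u| = d.+1) ->
  (0 < size q)%N -> path (adjacent G) v q -> uniq (v :: q) -> v \in S ->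
  (forall z, z \in S -> z \notin q) ->
  (forall z, z \notin S -> z \in q \/
     z \notin v :: q /\ exists2 w, w \in q & adjacent G z w) ->
  (forall a q' b, (size q' <= size q + k)%N -> last a q' = last v q ->
     ~~ lollipop G a q' b) ->
  branching G d k S v.
Proof.
move=> sG reg; elim: k S v q => [//|k IHk] S v q q0 pth unq vS Sq nS nolol.
case: q q0 pth unq Sq nS nolol => // w q _ pth unq Sq nS nolol.
have avw : adjacent G v w by case/andP: pth.
have NS : neighbours G v :&: S = neighbours G v :\ w.
  apply/setP => z; rewrite !inE andbC.
  case avz : (adjacent G v z); rewrite ?andbF ?andbT //.
  apply/idP/idP => [/Sq|zw]; first by rewrite inE negb_or => /andP[].
  apply: contraT => /nS [|[zvq [y yq azy]]].
    rewrite inE (negPf zw) /= => zq.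
    have := nolol v (w :: q) z; rewrite leq_addr => /(_ isT erefl).
    by rewrite /lollipop pth unq zq avz.
  have := nolol z [:: v, w & q] y.
  rewrite /= addnS ltnS addSn ltnS leq_addr => /(_ isT erefl).
  rewrite /lollipop /= in pth unq zvq yq *.
  by rewrite adjacentC avz pth unq zvq yq azy.
split.
  rewrite NS; have := cardsD1 w (neighbours G v).
  by rewrite reg inE avw add1n => -[].
move=> W u sW; rewrite NS in sW *; rewrite !inE => /and3P[uW uw avu].
have uS : u \in S.
  have : u \in neighbours G v :\ w by rewrite !inE uw.
  by rewrite -NS inE => /andP[].
have uv : u != v by apply: contraTneq avu => ->; rewrite adjacent_irrefl.
apply: (IHk _ _ [:: v, w & q]) => //.
- by rewrite /= adjacentC avu; exact: pth.
- by rewrite cons_uniq unq andbT inE (negPf uv) Sq.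
- by rewrite !inE uW uv.
- move=> z; rewrite in_cons !inE => /and3P[_ zv zS].
  by rewrite (negPf zv) (Sq _ zS).
- move=> z; rewrite !in_setD in_set1.
  case: (eqVneq z v) => [->|zv] /=; first by left; rewrite inE eqxx.
  rewrite negb_and negbK.
  case zS : (z \in S); last first.
    move=> _; case: (nS z (negbT zS)) => [zq|[zq [y yq azy]]].
      by left; rewrite in_cons zq orbT.
    right; split; last by exists y; rewrite // in_cons yq orbT.
    rewrite in_cons negb_or zq andbT.
    by apply: contraFneq zS => ->.
  rewrite /= orbF => zW; right.
  have := fintype.subsetP sW _ zW; rewrite !inE => /andP[zw avz].
  split; last by exists v; rewrite ?in_cons ?eqxx // adjacentC.
  rewrite (negPf zv) /=.
  have := Sq _ zS; rewrite inE => /negbTE ->; rewrite orbF.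
  by apply: contraNneq uW => <-.
- by move=> a q' b; rewrite addSnnS => sz lst; apply: nolol.
Qed.

(** The root has [d.+1] children, one more than the other vertices, so it cannot
    be described by [branching] itself. *)
Definition locally_tree (T : finType) (G : {set {set T}}) (d k : nat) (v : T) :=
  forall (W : {set T}) (u : T), W \subset neighbours G v ->
    u \in neighbours G v :\: W -> branching G d k ([set: T] :\ v :\: W) u.

(** The case of a path reduced to the root in [branching_of_no_lollipop], for each
    child of the root. *)
Lemma locally_tree_of_no_lollipop (T : finType) (G : {set {set T}}) (d k : nat)
    (v : T) :
  simple_graph G -> (forall u, #|neighbours G u| = d.+1) ->
  (forall a q b, (size q <= k.+1)%N -> last a q = v -> ~~ lollipop G a q b) ->
  locally_tree G d k v.
Proof.
move=> sG reg nolol W u sW; rewrite !inE => /andP[uW avu].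
have uv : u != v by apply: contraTneq avu => ->; rewrite adjacent_irrefl.
apply: (@branching_of_no_lollipop _ _ _ _ _ _ [:: v]) => //.
- by rewrite /= adjacentC avu.
- by rewrite /= inE uv.
- by rewrite !inE uW uv.
- by move=> z; rewrite !inE => /and3P[].
- move=> z; rewrite !inE andbT negb_and !negbK.
  case: (eqVneq z v) => [->|zv] /=; first by left.
  rewrite orbF => zW; right; split; last first.
    exists v; rewrite ?inE // adjacentC.
    by have := fintype.subsetP sW _ zW; rewrite inE.
  by rewrite orbF; apply: contraNneq uW => <-.
Qed.

(** * Switchings and the mean number of short cycles *)

(** The elementary move between graphs with the same degrees. *)
Definition switch (T : finType) (G : {set {set T}}) (a b c d : T) :
    {set {set T}} :=
  (G :\: [set [set a; b]; [set c; d]]) :|: [set [set a; c]; [set b; d]].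

Lemma set2_eqE (T : finType) (x y z w : T) :
  ([set x; y] == [set z; w]) = (x == z) && (y == w) || (x == w) && (y == z).
Proof.
apply/eqP/idP => [e|/orP[/andP[/eqP-> /eqP->]|/andP[/eqP-> /eqP->]]] //; last first.
  by rewrite finset.setUC.
have := erefl (x \in [set x; y]); rewrite {1}e !inE eqxx /=.
have := erefl (y \in [set x; y]); rewrite {1}e !inE eqxx orbT /=.
have := erefl (z \in [set z; w]); rewrite -{1}e !inE eqxx /=.
have := erefl (w \in [set z; w]); rewrite -{1}e !inE eqxx orbT /=.
rewrite ![z == _]eq_sym ![w == _]eq_sym.
by case: (x == z); case: (y == z); case: (x == w); case: (y == w).
Qed.

Definition switchable (T : finType) (G : {set {set T}}) (a b c d : T) : bool :=
  [&& adjacent G a b, adjacent G c d, ~~ adjacent G a c, ~~ adjacent G b d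
    & uniq [:: a; b; c; d]].

(** The reverse switching recovers the graph, so that switching is injective once
    the four vertices are fixed. *)
Lemma switchK (T : finType) (G : {set {set T}}) (a b c d : T) :
  switchable G a b c d -> switch (switch G a b c d) a c b d = G.
Proof.
rewrite /switchable /adjacent => /and5P[ab cd ac bd _].
apply/setP => e; rewrite !inE.
have [->|_] := eqVneq e [set a; b]; first by rewrite ab /= orbT.
have [->|_] := eqVneq e [set c; d]; first by rewrite cd /= orbT.
have [->|_] := eqVneq e [set a; c]; first by rewrite (negPf ac).
have [->|_] := eqVneq e [set b; d]; first by rewrite (negPf bd) orbT.
by rewrite /= !orbF.
Qed.

Lemma mem_pair_nat (T : finType) (x y v : T) : x != y ->
  (v \in [set x; y] : nat) = ((v == x) + (v == y))%N.
Proof.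
move=> xy; rewrite !inE; case: (eqVneq v x) => [->|] /=; last by case: eqP.
by rewrite (negPf xy).
Qed.

Lemma degree_split (T : finType) (G : {set {set T}}) (e f : {set T}) (v : T) :
  e \in G -> f \in G -> e != f ->
  degree G v = ((v \in e) + (v \in f) + degree (G :\: [set e; f]) v)%N.
Proof.
move=> eG fG ef; rewrite !degreeE (big_setID [set e; f]) /=.
have -> : G :&: [set e; f] = [set e; f].
  by apply/setIidPr; rewrite finset.subUset !sub1set eG fG.
by rewrite big_setU1 ?inE //= big_set1.
Qed.

Lemma switch_degree (T : finType) (G : {set {set T}}) (a b c d v : T) :
  switchable G a b c d -> degree (switch G a b c d) v = degree G v.
Proof.
rewrite /switchable /adjacent /= !inE !negb_or => /and5P[ab cd ac bd].
move=> /and4P[/and3P[nab nac nad] /andP[nbc nbd] ncd _].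
have dis1 : [set a; b] != [set c; d] by rewrite set2_eqE (negPf nac) (negPf nad).
have dis2 : [set a; c] != [set b; d] by rewrite set2_eqE (negPf nab) (negPf nad).
rewrite (degree_split v ab cd dis1).
have ac' : [set a; c] \in switch G a b c d by rewrite !inE eqxx orbT.
have bd' : [set b; d] \in switch G a b c d by rewrite !inE eqxx !orbT.
rewrite (degree_split v ac' bd' dis2).
have -> : switch G a b c d :\: [set [set a; c]; [set b; d]] =
          G :\: [set [set a; b]; [set c; d]].
  rewrite setDUl finset.setDv finset.setU0; apply/setP => e; rewrite !inE.
  case: (eqVneq e [set a; c]) => [->|_] /=; first by rewrite (negPf ac) andbF.
  by case: (eqVneq e [set b; d]) => [->|_] //=; rewrite (negPf bd) andbF.
by congr (_ + _)%N; rewrite !mem_pair_nat // addnACA.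
Qed.

Lemma switch_simple (T : finType) (G : {set {set T}}) (a b c d : T) :
  simple_graph G -> switchable G a b c d -> simple_graph (switch G a b c d).
Proof.
move=> /forall_inP sG; rewrite /switchable /= !inE !negb_or => /and5P[_ _ _ _].
move=> /and4P[/and3P[nab nac nad] /andP[nbc nbd] ncd _].
apply/forall_inP => e; rewrite !inE => /orP[/andP[_ /sG] //|].
by case/orP => /eqP ->; rewrite cards2 ?nac ?nbd.
Qed.

Lemma switch_regular (T : finType) (r : nat) (G : {set {set T}}) (a b c d : T) :
  regular_graph r G -> switchable G a b c d ->
  regular_graph r (switch G a b c d).
Proof.
move=> /andP[sG /forallP reg] sw; rewrite /regular_graph switch_simple //=.
by apply/forallP => v; rewrite switch_degree.
Qed.

Lemma switch_adjacent (T : finType) (G : {set {set T}}) (a b c d x y : T) :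
  adjacent G x y -> c != x -> c != y ->
  (a == x) && (b == y) = false -> (b == x) && (a == y) = false ->
  adjacent (switch G a b c d) x y.
Proof.
rewrite /adjacent /switch !inE !set2_eqE => ->.
rewrite ![x == _]eq_sym ![y == _]eq_sym.
by move=> /negbTE -> /negbTE -> -> ->; rewrite !andbF.
Qed.

Lemma switch_path_avoiding (T : finType) (G : {set {set T}}) (a b c d x : T)
    (q : seq T) :
  path (adjacent G) x q -> a \notin x :: q -> c \notin x :: q ->
  path (adjacent (switch G a b c d)) x q.
Proof.
elim: q x => //= y q IHq x /andP[axy pth].
rewrite !inE !negb_or => /and3P[ax ay aq] /and3P[cx cy cq].
rewrite switch_adjacent ?(negPf ax) ?(negPf ay) ?andbF //=.
by apply: IHq; rewrite ?inE ?negb_or ?ay ?cy.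
Qed.

(** Only the edges [ab] and [cd] disappear.  The vertex [b] is not the successor of
    [a], and [c] is not on the path, so neither edge belongs to it. *)
Lemma switch_path (T : finType) (G : {set {set T}}) (a b c d : T) (q : seq T) :
  path (adjacent G) a q -> uniq (a :: q) -> b \in behead q ->
  c \notin a :: q -> path (adjacent (switch G a b c d)) a q.
Proof.
case: q => // y q /= /andP[aay pth] /andP[aq /andP[yq _]] bq.
rewrite !inE !negb_or => /and3P[ca cy cq].
have ay : a != y by apply: contraNneq aq => ->; rewrite inE eqxx.
have byn : b != y by apply: contraNneq yq => <-.
rewrite switch_adjacent ?(negPf ay) ?(negPf byn) ?andbF //=.
by apply: switch_path_avoiding => //; rewrite inE negb_or cy.
Qed.

Definition lollipops (T : finType) (m : nat) (G : {set {set T}}) : nat :=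
  \sum_(x : T * m.-tuple T * T) lollipop G x.1.1 x.1.2 x.2.

(** The oriented edges that may be switched with the closing edge [ab] of the
    lollipop [(a, q, b)] without touching its path or creating a double edge. *)
Definition free_arc (T : finType) (G : {set {set T}}) (a : T) (q : seq T)
    (b : T) (p : T * T) : bool :=
  [&& adjacent G p.1 p.2, p.1 \notin a :: q, p.2 \notin a :: q,
      ~~ adjacent G a p.1 & ~~ adjacent G b p.2].

Lemma free_arc_switchable (T : finType) (G : {set {set T}}) (a b : T) (q : seq T)
    (p : T * T) :
  simple_graph G -> lollipop G a q b -> free_arc G a q b p ->
  switchable G a b p.1 p.2.
Proof.
move=> sG /and4P[_ unq bq ab] /and5P[cd cq dq ac bd].
rewrite /switchable ab cd ac bd /= !inE !negb_or.
have bq' : b \in q := mem_behead bq.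
move: unq cq dq; rewrite /= !inE !negb_or => /andP[aq _] /andP[ca cq] /andP[da dq].
rewrite ![a == p.1]eq_sym ca ![a == p.2]eq_sym da.
have -> : a != b by apply: contraNneq aq => ->.
have -> : b != p.1 by apply: contraNneq cq => <-.
have -> : b != p.2 by apply: contraNneq dq => <-.
by rewrite /= !andbT; apply: contraTneq cd => ->; rewrite adjacent_irrefl.
Qed.

Lemma card_arcs (T : finType) (G : {set {set T}}) (r : nat) (P : pred T) :
  (forall u, #|neighbours G u| = r) ->
  #|[set p : T * T | P p.1 && adjacent G p.1 p.2]| = (#|P| * r)%N.
Proof.
move=> reg; rewrite -sum1_card.
rewrite (eq_bigl (fun p : T * T => P p.1 && adjacent G p.1 p.2)); last by move=> p; rewrite inE.
rewrite -(pair_big_dep P (fun x y => adjacent G x y) (fun _ _ => 1%N)) /=.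
rewrite (eq_bigr (fun=> r)) ?sum_nat_const // => u _.
by rewrite sum1_card -(reg u); apply: eq_card => w; rewrite [RHS]inE.
Qed.

Lemma card_arcs_rev (T : finType) (G : {set {set T}}) (r : nat) (P : pred T) :
  (forall u, #|neighbours G u| = r) ->
  #|[set p : T * T | P p.2 && adjacent G p.1 p.2]| = (#|P| * r)%N.
Proof.
move=> reg; rewrite -(card_arcs P reg).
pose sw (p : T * T) := (p.2, p.1); have swK : involutive sw by case.
rewrite -(card_imset _ (inv_inj swK)); apply: eq_card => p.
rewrite inE; apply/imsetP/idP => [[z /[!inE] /andP[Pz az] ->] /=|h].
  by rewrite Pz adjacentC az.
by exists (sw p); rewrite ?swK // inE /= adjacentC.
Qed.

(** Among the [r|T|] oriented edges, those that are not free have an end on the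
    path or next to [a] or [b]; their number does not depend on the size of the
    graph. *)
Lemma card_free_arcs (T : finType) (G : {set {set T}}) (r : nat) (a b : T)
    (q : seq T) :
  (forall u, #|neighbours G u| = r) ->
  (#|T| * r <= #|[set p | free_arc G a q b p]|
      + 2 * (size q).+1 * r + 2 * (r * r))%N.
Proof.
move=> reg.
pose A1 := [set p : T * T | (p.1 \in a :: q) && adjacent G p.1 p.2].
pose A2 := [set p : T * T | (p.2 \in a :: q) && adjacent G p.1 p.2].
pose A3 := [set p : T * T | (p.1 \in neighbours G a) && adjacent G p.1 p.2].
pose A4 := [set p : T * T | (p.2 \in neighbours G b) && adjacent G p.1 p.2].
have c1 : (#|A1| <= (size q).+1 * r)%N.
  by rewrite [#|A1|](card_arcs (mem (a :: q)) reg) leq_mul2r (card_size (a :: q)) orbT.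
have c2 : (#|A2| <= (size q).+1 * r)%N.
  by rewrite [#|A2|](card_arcs_rev (mem (a :: q)) reg) leq_mul2r (card_size (a :: q)) orbT.
have c3 : #|A3| = (r * r)%N by rewrite [LHS](card_arcs (mem (neighbours G a)) reg) reg.
have c4 : #|A4| = (r * r)%N by rewrite [LHS](card_arcs_rev (mem (neighbours G b)) reg) reg.
have sub : [set p : T * T | true && adjacent G p.1 p.2] \subset
    [set p | free_arc G a q b p] :|: (A1 :|: A2 :|: (A3 :|: A4)).
  apply/fintype.subsetP => p; rewrite !in_setU !in_set /free_arc /= => ->.
  rewrite !andbT /=.
  by case: (p.1 \in a :: q); case: (p.2 \in a :: q);
    case: (adjacent G a p.1); case: (adjacent G b p.2).
have := subset_leq_card sub.
rewrite (card_arcs xpredT reg) => h.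
have := (leq_card_setU [set p | free_arc G a q b p] (A1 :|: A2 :|: (A3 :|: A4))).1.
have := (leq_card_setU (A1 :|: A2) (A3 :|: A4)).1.
have := (leq_card_setU A1 A2).1; have := (leq_card_setU A3 A4).1.
have cT : #|(xpredT : pred T)| = #|T| by apply: eq_card.
rewrite cT in h; rewrite c3 c4; lia.
Qed.

Lemma card_paths (T : finType) (G : {set {set T}}) (r m : nat) (a : T) :
  (forall u, #|neighbours G u| = r) ->
  (\sum_(q : m.-tuple T) path (adjacent G) a q = r ^ m)%N.
Proof.
move=> reg; elim: m a => [|m IHm] a.
  rewrite (eq_bigr (fun=> 1%N)) => [|q _]; last by rewrite tuple0.
  by rewrite sum1_card card_tuple.
rewrite (reindex (fun p : T * m.-tuple T => cons_tuple p.1 p.2)) /=; last first.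
  exists (fun q : m.+1.-tuple T => (thead q, behead_tuple q)) => [[x q] _|q _] /=.
    by congr (_, _); apply: val_inj.
  by rewrite [RHS]tuple_eta; apply: val_inj.
rewrite -(pair_bigA _ (fun x (q : m.-tuple T) =>
  (adjacent G a x && path (adjacent G) x q : nat))) /=.
transitivity (\sum_x (adjacent G a x : nat) * r ^ m)%N.
  apply: eq_bigr => x _; case: (adjacent G a x) => /=; last by rewrite big1.
  by rewrite IHm mul1n.
rewrite -big_distrl /= sum_nat_of_bool expnS -(reg a); congr (_ * _)%N.
by apply: eq_card => u; rewrite [RHS]inE.
Qed.

Definition regular_graphs (T : finType) (r : nat) : {set {set {set T}}} :=
  [set G | regular_graph r G].

(** Switching opens the lollipop but keeps its path, and the new edges leave from
    [a] and [b].  For fixed vertices this is an injection. *)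
Lemma switching_card (T : finType) (r : nat) (a b c d : T) (q : seq T) :
  (#|[set G in regular_graphs T r | lollipop G a q b && free_arc G a q b (c, d)]|
   <= #|[set G in regular_graphs T r | [&& path (adjacent G) a q, b \in q,
          adjacent G a c & adjacent G b d]]|)%N.
Proof.
set A := [set G in _ | _]; set B := [set G in _ | _].
have sw G : G \in A -> switchable G a b c d.
  rewrite !inE => /and3P[/andP[sG _] lol fr].
  exact: (free_arc_switchable sG lol fr).
rewrite -(card_in_imset (f := fun G => switch G a b c d)); last first.
  move=> G1 G2 /sw sw1 /sw sw2 e.
  by rewrite -(switchK sw1) e switchK.
apply/subset_leq_card/fintype.subsetP => _ /imsetP[G GA ->].
have swG := sw G GA; move: GA; rewrite !inE => /and3P[reg lol fr].
rewrite switch_regular //=.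
move: lol fr => /and4P[pth unq bq _] /and5P[_ cq _ _ _].
rewrite switch_path //= /adjacent !inE !eqxx !orbT !andbT.
exact: mem_behead bq.
Qed.

Definition lollipop_constant (r m : nat) : nat := (r ^ m * (m * (r * r)))%N.
Definition switching_threshold (r m : nat) : nat := (2 * m.+1 * r + 2 * (r * r))%N.

(** After the switching nothing forces [b] to be adjacent to [a] any more.  There
    are [r^m] paths from each vertex, and a bounded number of choices for the
    remaining data, hence the count is only linear in the number of vertices. *)
Lemma card_switch_targets (T : finType) (G : {set {set T}}) (r m : nat) :
  (forall u, #|neighbours G u| = r) ->
  (\sum_(x : T * m.-tuple T * T) \sum_(p : T * T)
     [&& path (adjacent G) x.1.1 x.1.2, x.2 \in (x.1.2 : seq T),
         adjacent G x.1.1 p.1 & adjacent G x.2 p.2]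
   <= #|T| * lollipop_constant r m)%N.
Proof.
move=> reg.
have arcs a b : (\sum_(p : T * T) (adjacent G a p.1 && adjacent G b p.2) = r * r)%N.
  rewrite sum_nat_of_bool -{1}(reg a) -(reg b) -cardsX.
  by apply: eq_card => p; case: p => x y; rewrite [RHS]finset.in_setX !inE.
rewrite -(pair_bigA _ (fun (y : T * m.-tuple T) (b : T) => \sum_(p : T * T)
     [&& path (adjacent G) y.1 y.2, b \in (y.2 : seq T),
         adjacent G y.1 p.1 & adjacent G b p.2]))%N /=.
rewrite -(pair_bigA _ (fun (a : T) (q : m.-tuple T) => \sum_(b : T) \sum_(p : T * T)
     [&& path (adjacent G) a q, b \in (q : seq T),
         adjacent G a p.1 & adjacent G b p.2]))%N /=.
apply: (@leq_trans (\sum_(a : T) r ^ m * (m * (r * r)))%N); last first.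
  by rewrite sum_nat_const.
apply: leq_sum => a _; rewrite -(card_paths m a reg) big_distrl /=.
apply: leq_sum => q _.
case: (path _ _ _) => /=; last first.
  by rewrite big1 // => b _; rewrite big1.
rewrite mul1n; apply: (@leq_trans (\sum_(b : T) (b \in (q : seq T)) * (r * r))%N).
  apply: leq_sum => b _; case: (b \in _) => /=; last by rewrite big1.
  by rewrite arcs mul1n.
rewrite -big_distrl /= leq_mul2r sum_nat_of_bool.
by rewrite -{2}(size_tuple q) card_size orbT.
Qed.

(** The average number of lollipops of a given length is bounded independently of
    the number of vertices.  Each lollipop can be opened in at least [|T|] ways,
    while the opened configurations number at most a constant times [|T|] in each
    graph. *)
Lemma switching_bound (T : finType) (r m : nat) :
  (1 < r)%N -> (switching_threshold r m <= #|T|)%N ->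
  (\sum_(G in regular_graphs T r) lollipops m G
    <= #|regular_graphs T r| * lollipop_constant r m)%N.
Proof.
move=> r1 thr.
have T0 : (0 < #|T|)%N by apply: leq_trans thr; rewrite /switching_threshold; lia.
have reg G : G \in regular_graphs T r -> forall u, #|neighbours G u| = r.
  rewrite inE => /andP[sG /forallP dG] u.
  by rewrite card_neighbours //; apply/eqP.
rewrite -(leq_pmul2l T0) big_distrr /=.
apply: (@leq_trans (\sum_(G in regular_graphs T r)
   \sum_(x : T * m.-tuple T * T) \sum_(p : T * T)
     (lollipop G x.1.1 x.1.2 x.2 && free_arc G x.1.1 x.1.2 x.2 (p.1, p.2)))%N).
  apply: leq_sum => G GR; rewrite /lollipops big_distrr /=.
  apply: leq_sum => x _; case: (lollipop _ _ _ _) => /=; last by rewrite muln0.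
  rewrite muln1 sum_nat_of_bool; set F := (X in (_ <= X)%N).
  have := card_free_arcs x.1.1 x.2 x.1.2 (reg G GR); rewrite size_tuple.
  have -> : #|[set p | free_arc G x.1.1 x.1.2 x.2 p]| = F.
    by apply: eq_card => -[c d]; rewrite [LHS]inE.
  move: thr; rewrite /switching_threshold.
  have arith (N Z X Y M : nat) :
    (N * 2 <= Z -> X + Y <= N -> Z <= M + X + Y -> N <= M)%N by lia.
  by apply: arith; rewrite leq_mul2l r1 orbT.
apply: (@leq_trans (\sum_(G in regular_graphs T r)
   \sum_(x : T * m.-tuple T * T) \sum_(p : T * T)
     [&& path (adjacent G) x.1.1 x.1.2, x.2 \in (x.1.2 : seq T),
         adjacent G x.1.1 p.1 & adjacent G x.2 p.2])%N); last first.
  rewrite mulnCA -[leqRHS]sum_nat_const; apply: leq_sum => G GR.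
  exact: card_switch_targets (reg G GR).
rewrite exchange_big [leqRHS]exchange_big /=; apply: leq_sum => x _.
rewrite exchange_big [leqRHS]exchange_big /=; apply: leq_sum => p _.
have cardE (P : pred {set {set T}}) :
    (\sum_(G in regular_graphs T r) (P G : nat) =
     #|[set G in regular_graphs T r | P G]|)%N.
  rewrite -sum1_card [LHS]big_mkcond [RHS]big_mkcond; apply: eq_bigr => G _.
  by rewrite !inE; case: (regular_graph r G); case: (P G).
by rewrite !cardE switching_card.
Qed.

(** Each vertex whose neighbourhood is not a tree is the end of a lollipop, and
    each lollipop has one end. *)
Lemma card_not_locally_tree (T : finType) (G : {set {set T}}) (d k : nat) :
  simple_graph G -> (forall u, #|neighbours G u| = d.+1) ->
  (#|[set v | `[< ~ locally_tree G d k v >]]| <= \sum_(m < k.+2) lollipops m G)%N.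
Proof.
move=> sG reg.
apply: (@leq_trans (\sum_(v : T) \sum_(m < k.+2)
   \sum_(x : T * m.-tuple T * T)
     (last x.1.1 x.1.2 == v) * lollipop G x.1.1 x.1.2 x.2)%N); last first.
  rewrite exchange_big /=; apply: leq_sum => m _.
  rewrite exchange_big /=; apply: leq_sum => x _.
  rewrite -big_distrl /= (bigD1 (last x.1.1 x.1.2)) //= eqxx big1 ?addn0 ?mul1n //.
  by move=> v /negbTE; rewrite eq_sym => ->.
rewrite -sum1_card big_mkcond /=; apply: leq_sum => v _.
rewrite inE; case: asboolP => // nlt.
rewrite lt0n; apply/eqP => /eqP; rewrite sum_nat_eq0 => /forall_inP H.
apply: nlt; apply: locally_tree_of_no_lollipop => // a q b sq lst.
have := H (Ordinal (sq : size q < k.+2)%N) isT; rewrite sum_nat_eq0 => /forall_inP.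
by move=> /(_ (a, in_tuple q, b) isT) /=; rewrite lst eqxx mul1n eqb0.
Qed.

(** * The derivative of the logarithm of the partition function *)

Lemma partition_functionE (R : realType) (T : finType) (t : R) (G : {set {set T}}) :
  partition_function t G = hardcore t G [set: T].
Proof. by apply: eq_bigl => I; rewrite finset.subsetT andbT. Qed.

Lemma partition_function0 (R : realType) (T : finType) (G : {set {set T}}) :
  simple_graph G -> partition_function (0 : R) G = 1.
Proof.
move=> sG; rewrite /partition_function (bigD1 finset.set0) /=; last first.
  by apply/independentP => // u v; rewrite inE.
rewrite cards0 expr0 big1 ?addr0 // => I /andP[_ I0].
by rewrite expr0n cards_eq0 (negPf I0).
Qed.

(** Differentiating [t^|I|] gives one term for each vertex of [I]; collecting the
    terms by vertices gives the independent sets that contain a given vertex. *)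
Lemma is_derive_partition_function (R : realType) (T : finType) (t : R)
    (G : {set {set T}}) :
  simple_graph G ->
  is_derive t 1 (fun s : R => partition_function s G)
    (\sum_(v : T) hardcore t G ([set: T] :\ v :\: neighbours G v)).
Proof.
move=> sG.
pose p : {poly R} := \sum_(I : {set T} | independent G I) 'X^#|I|.
have -> : (fun s : R => partition_function s G) = horner p.
  apply/funext => s; rewrite /p horner_sum /partition_function.
  by apply: eq_bigr => I _; rewrite hornerXn.
apply: (is_derive_eq (is_derive_poly p t)).
rewrite /p raddf_sum horner_sum.
transitivity (\sum_(I : {set T} | independent G I) \sum_(v in I) t ^+ #|I|.-1).
  apply: eq_bigr => I _.
  by rewrite /= derivXn hornerMn hornerXn sumr_const.
rewrite (exchange_big_dep xpredT) //=; apply: eq_bigr => v _.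
have /= occ := hardcore_occupied (fun m => t ^+ m.-1) sG (finset.in_setT v).
rewrite /hardcore -occ; by apply: eq_bigl => I; rewrite finset.subsetT andbT.
Qed.

Lemma exprn_diff_le (R : realType) (m : nat) (p q : R) :
  0 <= q -> q <= p -> p <= 1 -> p ^+ m - q ^+ m <= m%:R * (p - q).
Proof.
move=> q0 qp p1; elim: m => [|m IHm]; first by rewrite !expr0 subrr mul0r.
have p0 : 0 <= p by exact: le_trans qp.
have q1 : q <= 1 by exact: le_trans p1.
rewrite !exprS -natr1.
have -> : p * p ^+ m - q * q ^+ m = p * (p ^+ m - q ^+ m) + q ^+ m * (p - q) by ring.
rewrite mulrDl mul1r lerD //.
  apply: le_trans IHm; rewrite ler_piMl // subr_ge0.
  by rewrite lerXn2r.
by rewrite ler_piMl ?subr_ge0 // exprn_ile1.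
Qed.

Lemma inv_exprn_diff_le (R : realType) (m : nat) (lo hi : R) :
  0 <= lo -> lo <= hi ->
  ((1 + lo) ^+ m)^-1 - ((1 + hi) ^+ m)^-1 <= m%:R * (hi - lo).
Proof.
move=> lo0 lohi.
have l1 : 0 < 1 + lo by rewrite ltr_pwDl.
have h1 : 0 < 1 + hi by rewrite ltr_pwDl // (le_trans lo0).
rewrite -!exprVn.
have ql : (1 + hi)^-1 <= (1 + lo)^-1 by rewrite lef_pV2 ?posrE // lerD2l.
have q0 : 0 <= (1 + hi)^-1 by rewrite invr_ge0 ltW.
have p1 : (1 + lo)^-1 <= 1 by rewrite invf_le1 // lerDl.
apply: le_trans (exprn_diff_le m q0 ql p1) _.
rewrite ler_wpM2l //.
have -> : (1 + lo)^-1 - (1 + hi)^-1 = (hi - lo) * ((1 + lo)^-1 * (1 + hi)^-1).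
  by field; rewrite !gt_eqF.
by rewrite ler_piMr ?subr_ge0 // mulr_ile1 ?(le_trans ql p1) // invr_ge0 ltW.
Qed.

(** The occupation probability of [v] divided by [t].  The quotient keeps a
    meaning at [t = 0]; the sum over [v] is the logarithmic derivative of the
    partition function. *)
Definition occupation_derivative (R : realType) (T : finType) (t : R)
    (G : {set {set T}}) (v : T) : R :=
  hardcore t G ([set: T] :\ v :\: neighbours G v) / hardcore t G [set: T].

Lemma occupation_derivative_itv (R : realType) (T : finType) (t : R)
    (G : {set {set T}}) (v : T) :
  simple_graph G -> 0 <= t -> 0 <= occupation_derivative t G v <= 1.
Proof.
move=> sG t0; have Z0 := hardcore_gt0 [set: T] sG t0.
rewrite divr_ge0 ?(ltW Z0) ?(ltW (hardcore_gt0 _ sG t0)) //=.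
rewrite ler_pdivrMr // mul1r /hardcore [leRHS](bigID (fun I : {set T} =>
  I \subset [set: T] :\ v :\: neighbours G v)) /= ler_wpDr //.
  by apply: sumr_ge0 => I _; exact: exprn_ge0.
by rewrite le_eqVlt; apply/orP; left; apply/eqP; apply: eq_bigl => I;
  rewrite finset.subsetT andbT.
Qed.

(** Both sides have the form [Y/(1 + tY)], where [Y] is the probability that the
    neighbours are vacant in the absence of the root.  For the graph [Y] lies
    between [(1+hi)^-(d+1)] and [(1+lo)^-(d+1)], with [lo] and [hi] the bounds of
    [tree_bounds]; for the infinite tree [Y = x^(d+1)], which lies between them too, because
    [(1-x)/x] is the fixed point of [tree_map]. *)
Lemma occupation_derivative_close (R : realType) (T : finType) (t x : R)
    (G : {set {set T}}) (d k : nat) (v : T) :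
  simple_graph G -> #|neighbours G v| = d.+1 -> locally_tree G d k v ->
  0 <= t -> 0 < x -> x + t * x ^+ d.+1 = 1 ->
  `|occupation_derivative t G v - x ^+ d.+1 / (2 - x)| <=
    d.+1%:R * ((tree_bounds d t k).2 - (tree_bounds d t k).1).
Proof.
move=> sG cN lt t0 x0 fx.
have [lo0 lohi _] := tree_bounds_le d k t0.
have xd0 : 0 < x ^+ d by rewrite exprn_gt0.
have x1 : x <= 1 by rewrite -fx lerDl mulr_ge0 // exprn_ge0 // ltW.
pose rho := (1 - x) / x.
have rho1 : 1 + rho = x^-1 by rewrite /rho; field; rewrite gt_eqF.
have rho0 : 0 <= rho by rewrite divr_ge0 ?subr_ge0 // ltW.
have rhoE : tree_map d t rho = rho.
  rewrite /tree_map rho1 exprVn invrK /rho.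
  rewrite (_ : 1 - x = t * x ^+ d.+1); last by lra.
  by rewrite exprS; field; rewrite gt_eqF.
have := tree_bounds_fixed_point k t0 rho0 rhoE.
move: lt; rewrite /locally_tree.
set lo := (tree_bounds d t k).1 in lo0 lohi *.
set hi := (tree_bounds d t k).2 in lohi *.
move=> lt /andP[lorho rhohi].
have hi0 := le_trans lo0 lohi.
have NT : neighbours G v :&: [set: T] = neighbours G v by rewrite finset.setIT.
have bnd (W : {set T}) (u : T) : W \subset neighbours G v :&: [set: T] ->
   u \in (neighbours G v :&: [set: T]) :\: W ->
   lo <= occupation_ratio t G ([set: T] :\ v :\: W) u <= hi.
  by rewrite NT => sW uW; apply: branching_ratio_bounds => //; exact: lt.
have := hardcore_remove_neighbours sG t0 lo0 hi0 bnd; rewrite NT cN.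
set Y := _ / _ => /andP[Y1 Y2].
have Z1 := hardcore_gt0 ([set: T] :\ v) sG t0.
have -> : occupation_derivative t G v = Y / (1 + t * Y).
  rewrite /occupation_derivative (hardcore_ratio sG t0 (finset.in_setT v)).
  rewrite /occupation_ratio -mulrA -/Y invfM mulrA; congr (_ * _).
have y1 : ((1 + hi) ^+ d.+1)^-1 <= x ^+ d.+1 <= ((1 + lo) ^+ d.+1)^-1.
  have -> : x = (1 + rho)^-1 by rewrite rho1 invrK.
  rewrite exprVn !lef_pV2 ?posrE ?exprn_gt0 ?ltr_pwDl //.
  by rewrite !lerXn2r ?nnegrE ?addr_ge0 ?lerD2l.
have Y0 : 0 <= Y by apply: le_trans Y1; rewrite invr_ge0 exprn_ge0 // addr_ge0.
have tx : 2 - x = 1 + t * x ^+ d.+1 by lra.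
have tY : 0 <= t * Y by rewrite mulr_ge0.
have tx0 : 0 <= t * x ^+ d.+1 by rewrite mulr_ge0 // exprn_ge0 // ltW.
set y := x ^+ d.+1 in y1 tx tx0 *.
rewrite tx.
have -> : Y / (1 + t * Y) - y / (1 + t * y) = (Y - y) / ((1 + t * Y) * (1 + t * y)).
  by field; rewrite !gt_eqF // ltr_pwDl.
apply: le_trans (inv_exprn_diff_le d.+1 lo0 lohi).
have den : 1 <= (1 + t * Y) * (1 + t * y) by rewrite mulr_ege1 // lerDl.
rewrite normrM normfV [X in _ / X]ger0_norm; last lra.
apply: (@le_trans _ _ `|Y - y|).
  by rewrite ler_pdivrMr ?ler_peMr //; lra.
by move: y1 => /andP[y1 y2]; rewrite ler_norml; lra.
Qed.

(** Vertices with a neighbourhood that is not a tree contribute at most 1 each,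
    since both quantities are in [[0, 1]]. *)
Lemma average_occupation_close (R : realType) (T : finType) (t x : R)
    (G : {set {set T}}) (d k : nat) :
  regular_graph d.+1 G ->
  0 <= t -> 0 < x -> x + t * x ^+ d.+1 = 1 ->
  `|\sum_(v : T) (occupation_derivative t G v - x ^+ d.+1 / (2 - x))| <=
    #|T|%:R * (d.+1%:R * ((tree_bounds d t k).2 - (tree_bounds d t k).1))
    + #|[set v | `[< ~ locally_tree G d k v >]]|%:R.
Proof.
move=> /andP[sG /forallP reg] t0 x0 fx.
have [lo0 lohi _] := tree_bounds_le d k t0.
set c := x ^+ d.+1 / (2 - x); set g := d.+1%:R * _.
have g0 : 0 <= g by rewrite mulr_ge0 // subr_ge0.
apply: le_trans (ler_norm_sum _ _ _) _.
apply: (@le_trans _ _ (\sum_(v : T) (g + (v \in [set v | `[< ~ locally_tree G d k v >]])%:R))).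
  apply: ler_sum => v _; rewrite inE.
  case: asboolP => [_|/contrapT lt].
    have x1 : x <= 1 by rewrite -fx lerDl mulr_ge0 // exprn_ge0 // ltW.
    have /andP[occ0 occ1] := occupation_derivative_itv v sG t0.
    have cge0 : 0 <= c by rewrite divr_ge0 ?exprn_ge0 ?(ltW x0) //; lra.
    have cle1 : c <= 1.
      rewrite ler_pdivrMr; last lra.
      by rewrite mul1r (@le_trans _ _ 1) ?exprn_ile1 ?(ltW x0) //; lra.
    by rewrite /= ler_norml; lra.
  rewrite addr0; apply: occupation_derivative_close => //.
  by rewrite card_neighbours //; exact/eqP.
rewrite big_split /= sumr_const -[g *+ _]mulr_natl lerD2l.
by rewrite -natr_sum sum_nat_of_bool.
Qed.

(** The activity for which [x] solves the fixed point equation.  Using [x] as the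
    parameter in place of the activity makes the limit an explicit function and
    avoids differentiating the solution of an implicit equation. *)
Definition activity (R : realType) (r : nat) (x : R) : R := (1 - x) / x ^+ r.

Definition activity_deriv (R : realType) (r : nat) (x : R) : R :=
  - (x + r%:R * (1 - x)) / x ^+ r.+1.

(** The limit of the theorem, with the logarithm of the product expanded. *)
Definition bethe_density (R : realType) (r : nat) (x : R) : R :=
  - (r%:R / 2) * ln x - (r%:R - 2) / 2 * ln (2 - x).

Lemma is_derive_activity (R : realType) (r : nat) (x : R) : 0 < x ->
  is_derive x 1 (activity r) (activity_deriv r x).
Proof.
move=> x0.
have d1 : is_derive x 1 (fun y : R => 1 - y) (- 1).
  have := is_deriveB (is_derive_cst (1 : R) x (1 : R)) (is_derive_id x (1 : R)).
  by rewrite sub0r.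
have d2 := is_deriveX r (is_derive_id x (1 : R)).
have nz : (id ^+ r : R -> R) x != 0 by rewrite fctE expf_neq0 // gt_eqF.
have d3 := is_deriveM d1 (is_deriveV nz d2).
have -> : activity r = (fun y : R => 1 - y) * (fun y : R => ((id ^+ r : R -> R) y)^-1).
  by apply/funext => y; rewrite /activity !fctE.
apply: (is_derive_eq d3).
rewrite !fctE /activity_deriv /= /GRing.scale /=.
case: r {d2 nz d3} => [|r].
  by rewrite /= !expr0 expr1; field; rewrite gt_eqF.
rewrite /= !exprS; field.
by rewrite !gt_eqF // exprn_gt0.
Qed.

(** The first factor comes from the change of variable.  The derivative of the
    limit with respect to the activity is [x^r/(2-x)], the value of
    [occupation_derivative] at the root of the infinite [r]-regular tree. *)
Lemma is_derive_bethe (R : realType) (r : nat) (x : R) : 0 < x < 2 ->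
  is_derive x 1 (bethe_density r)
    (activity_deriv r x * (x ^+ r / (2 - x))).
Proof.
move=> /andP[x0 x2].
have x2' : 0 < 2 - x by rewrite subr_gt0.
have d1 : is_derive x 1 (fun y : R => 2 - y) (- 1).
  have := is_deriveB (is_derive_cst (2 : R) x (1 : R)) (is_derive_id x (1 : R)).
  by rewrite sub0r.
have d2 := @is_derive1_comp _ (@ln R) (fun y : R => 2 - y) x _ _
  (is_derive1_ln x2') d1.
have d3 := is_deriveB (is_deriveZ (- (r%:R / 2)) (is_derive1_ln x0))
  (is_deriveZ ((r%:R - 2) / 2) d2).
apply: (is_derive_eq d3).
rewrite /activity_deriv /GRing.scale /= exprS; field.
by rewrite !gt_eqF // exprn_gt0.
Qed.

Lemma activity_deriv_le (R : realType) (r : nat) (x0 x : R) :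
  0 < x0 -> x0 <= x -> x <= 1 ->
  `|activity_deriv r x| <= r.+1%:R / x0 ^+ r.+1.
Proof.
move=> x00 x0x x1; have xp : 0 < x by exact: lt_le_trans x0x.
rewrite /activity_deriv mulNr normrN ger0_norm; last first.
  by rewrite divr_ge0 ?exprn_ge0 ?addr_ge0 ?mulr_ge0 ?subr_ge0 ?(ltW xp).
apply: ler_pM.
- by rewrite addr_ge0 ?mulr_ge0 ?subr_ge0 ?(ltW xp).
- by rewrite invr_ge0 exprn_ge0 // ltW.
- have r0 : 0 <= r%:R * x :> R by rewrite mulr_ge0 // ltW.
  by rewrite -natr1; lra.
- rewrite lef_pV2 ?posrE ?exprn_gt0 // lerXn2r // nnegrE ltW //.
Qed.

(** Mean value theorem on [[x0, 1]] for the difference of the two densities, as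
    functions of [x].  The difference vanishes at [x = 1], where the activity is 0,
    and its derivative is [activity_deriv] times the average of the errors bounded
    in [average_occupation_close]. *)
Lemma log_partition_close (R : realType) (n d k : nat) (lambda x0 gap : R)
    (G : {set {set 'I_n}}) :
  (0 < n)%N -> regular_graph d.+1 G -> 0 < lambda ->
  0 < x0 -> x0 + lambda * x0 ^+ d.+1 = 1 ->
  (forall t : R, 0 < t <= lambda ->
     (tree_bounds d t k).2 - (tree_bounds d t k).1 <= gap) ->
  `|log_partition_density lambda G - bethe_density d.+1 x0| <=
    d.+2%:R / x0 ^+ d.+2 *
      (d.+1%:R * gap + #|[set v | `[< ~ locally_tree G d k v >]]|%:R / n%:R).
Proof.
move=> n0 reg l0 x00 fx gapP.
have sG : simple_graph G by case/andP: reg.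
have nR0 : 0 < n%:R :> R by rewrite ltr0n.
have x01 : x0 < 1.
  by rewrite -fx ltrDl mulr_gt0 // exprn_gt0.
set bad := #|_|.
have act0 : activity d.+1 x0 = lambda.
  rewrite /activity (_ : 1 - x0 = lambda * x0 ^+ d.+1); last lra.
  by rewrite mulfK // gt_eqF // exprn_gt0.
pose h (x : R) := ln (partition_function (activity d.+1 x) G) / n%:R
   - bethe_density d.+1 x.
pose dh (x : R) := activity_deriv d.+1 x *
  ((\sum_(v : 'I_n) (occupation_derivative (activity d.+1 x) G v
       - x ^+ d.+1 / (2 - x))) / n%:R).
have act_ge0 (x : R) : 0 < x -> x <= 1 -> 0 <= activity d.+1 x.
  by move=> xp x1; rewrite divr_ge0 ?subr_ge0 // exprn_ge0 // ltW.
have dhP (x : R) : 0 < x -> x <= 1 -> is_derive x 1 h (dh x).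
  move=> xp x1; have t0 := act_ge0 x xp x1.
  have Z0 : 0 < partition_function (activity d.+1 x) G.
    by rewrite partition_functionE hardcore_gt0.
  have d1 := is_derive1_comp (is_derive_partition_function (activity d.+1 x) sG)
    (is_derive_activity d.+1 xp).
  have d2 := is_derive1_comp (is_derive1_ln Z0) d1.
  have x02 : 0 < x < 2 by rewrite xp; lra.
  have d3 := is_deriveB (is_deriveZ n%:R^-1 d2) (is_derive_bethe d.+1 x02).
  have -> : h = n%:R^-1 \*: (@ln R \o ((fun s : R => partition_function s G) \o activity d.+1))
      - bethe_density d.+1.
    by apply/funext => y; rewrite /h /= !fctE /GRing.scale /= mulrC.
  apply: (is_derive_eq d3).
  rewrite /dh /GRing.scale /= sumrB sumr_const card_ord -[_ *+ n]mulr_natl.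
  rewrite /occupation_derivative -mulr_suml -partition_functionE.
  field.
  by rewrite !gt_eqF //; lra.
have h1 : h 1 = 0.
  rewrite /h /activity subrr mul0r partition_function0 // ln1 mul0r sub0r.
  rewrite /bethe_density ln1 mulr0 sub0r (_ : 2 - 1 = 1); last by lra.
  by rewrite ln1 mulr0 oppr0 oppr0.
have hx0 : log_partition_density lambda G - bethe_density d.+1 x0 = h x0.
  by rewrite /h act0.
have cont : {within `[x0, 1], continuous h}%classic.
  apply: derivable_within_continuous => x; rewrite in_itv /= => /andP[xx0 xx1].
  have := dhP x (lt_le_trans x00 xx0) xx1 => dx.
  exact: (@ex_derive _ _ _ _ _ _ _ dx).
have dhP' (x : R) : x \in `]x0, 1[ -> is_derive x 1 h (dh x).
  rewrite in_itv /= => /andP[xx0 xx1].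
  exact: dhP (lt_trans x00 xx0) (ltW xx1).
have [c] := MVT x01 dhP' cont.
rewrite in_itv /= => /andP[cx0 c1] hc.
have c0 := lt_trans x00 cx0.
rewrite hx0 -normrN -sub0r -h1 hc normrM.
apply: (@le_trans _ _ `|dh c|).
  by rewrite ler_piMr // ger0_norm; lra.
rewrite /dh normrM; apply: ler_pM => //.
  by apply: activity_deriv_le => //; exact: ltW.
have tpos : 0 < activity d.+1 c by rewrite divr_gt0 ?subr_gt0 // exprn_gt0.
have tle : activity d.+1 c <= lambda.
  rewrite -act0 /activity; apply: ler_pM.
  - by rewrite subr_ge0 ltW.
  - by rewrite invr_ge0 exprn_ge0 // ltW.
  - by rewrite lerB // ltW.
  - by rewrite lef_pV2 ?posrE ?exprn_gt0 // lerXn2r ?nnegrE // ?ltW.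
have fc : c + activity d.+1 c * c ^+ d.+1 = 1.
  by rewrite divfK ?gt_eqF ?exprn_gt0 //; lra.
have := average_occupation_close k reg (ltW tpos) c0 fc.
rewrite card_ord -/bad => avg.
rewrite normrM [`|n%:R^-1|]ger0_norm ?invr_ge0 // ler_pdivrMr //.
apply: le_trans avg _.
rewrite [leRHS]mulrDl divfK ?gt_eqF // lerD2r mulrC ler_wpM2r // ler_wpM2l //.
by apply: gapP; rewrite tpos.
Qed.

(** * Convergence in probability *)

Lemma sum_not_locally_tree (T : finType) (d k : nat) :
  (0 < d)%N -> (switching_threshold d.+1 k.+1 <= #|T|)%N ->
  (\sum_(G in regular_graphs T d.+1) #|[set v | `[< ~ locally_tree G d k v >]]|
   <= #|regular_graphs T d.+1| * \sum_(m < k.+2) lollipop_constant d.+1 m)%N.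
Proof.
move=> d0 thr.
apply: (@leq_trans (\sum_(G in regular_graphs T d.+1)
    \sum_(m < k.+2) lollipops m G)%N).
  apply: leq_sum => G; rewrite inE => /andP[sG /forallP reg].
  apply: card_not_locally_tree => // u.
  by rewrite card_neighbours //; exact/eqP.
rewrite exchange_big big_distrr /=; apply: leq_sum => m _.
apply: switching_bound => //; apply: leq_trans thr.
rewrite /switching_threshold leq_add2r leq_mul2r leq_mul2l.
by rewrite (ltn_ord m) !orbT.
Qed.

(** Markov's inequality for the uniform measure on regular graphs, for a counting
    variable [f] with mean at most [K]. *)
Lemma random_regular_markov (R : realType) (r n : nat)
    (A : pred {set {set 'I_n}}) (f : {set {set 'I_n}} -> nat) (s : R) (K : nat) :
  0 < s -> (forall G, regular_graph r G -> A G -> s <= (f G)%:R) ->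
  (\sum_(G in regular_graphs 'I_n r) f G <= #|regular_graphs 'I_n r| * K)%N ->
  random_regular_prob R r A <= K%:R / s.
Proof.
move=> s0 Af sumf; rewrite /random_regular_prob.
have -> : #|[pred G : {set {set 'I_n}} | regular_graph r G]| = #|regular_graphs 'I_n r|.
  by apply: eq_card => G; rewrite !inE.
have [->|] := posnP #|regular_graphs 'I_n r|.
  by rewrite invr0 mulr0 divr_ge0 // ltW.
rewrite -(ltr0n R) => N0.
rewrite ler_pdivrMr // mulrAC ler_pdivlMr //.
rewrite -natrM mulnC; apply: le_trans (_ : (\sum_(G in regular_graphs 'I_n r) f G)%:R <= _); last first.
  by rewrite ler_nat.
rewrite natr_sum -sum1_card natr_sum mulr_suml.
rewrite [leRHS](bigID A) /= ler_wpDr ?sumr_ge0 //.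
rewrite [leLHS](eq_bigl (fun G => (G \in regular_graphs 'I_n r) && A G)); last first.
  by move=> G; rewrite !inE.
by apply: ler_sum => G /andP[]; rewrite inE => reg AG; rewrite mul1r Af.
Qed.

(** The depth [k] is chosen first, so that the deterministic part of the error in
    [log_partition_close] is below [delta/2].  The rest of the error is then a
    constant times the proportion of vertices whose neighbourhood is not a tree,
    and this proportion has mean [O(1/n)]. *)
Lemma cvg_whp_bethe (R : realType) (d : nat) (lambda x : R) :
  (0 < d)%N -> 0 < lambda -> (lambda%:E < critical_activity R d.+1)%E ->
  0 < x -> x + lambda * x ^+ d.+1 = 1 ->
  cvg_whp d.+1 (log_partition_density lambda) (bethe_density d.+1 x).
Proof.
move=> d0 l0 crit x0 fx delta delta0.
have [alpha /andP[a0 a1] contr] := contraction_factor d0 l0 crit.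
set C := d.+2%:R / x ^+ d.+2.
have C0 : 0 < C by rewrite divr_gt0 // exprn_gt0.
pose D : R := 2 * (1 + lambda) * contraction_coordinate lambda.
have [k hk] : exists k, C * (d.+1%:R * (D * alpha ^+ k)) < delta / 2.
  have : (C * (d.+1%:R * (D * alpha ^+ k)) @[k --> \oo] --> (0 : R))%classic.
    rewrite -[X in (_ --> X)%classic](mulr0 C); apply: cvgMr.
    rewrite -[X in (_ --> X)%classic](mulr0 d.+1%:R); apply: cvgMr.
    rewrite -[X in (_ --> X)%classic](mulr0 D); apply: cvgMr.
    by apply: cvg_expr; rewrite ger0_norm.
  move=> /cvgrPdist_lt /(_ (delta / 2)) [].
    by rewrite divr_gt0.
  move=> k _ /(_ k) /=; rewrite leqnn => /(_ isT) hk.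
  exists k; rewrite sub0r normrN in hk.
  exact: le_lt_trans (ler_norm _) hk.
set K := (\sum_(m < k.+2) lollipop_constant d.+1 m)%N.
apply: cvg_within_filter; apply/cvgrPdist_lt => eps eps0.
near=> n.
have n0 : (0 < n)%N by near: n; exact: nbhs_infty_gt.
have thr : (switching_threshold d.+1 k.+1 <= #|'I_n|)%N.
  by rewrite card_ord; near: n; exact: nbhs_infty_ge.
have nbig : K%:R / (delta / (2 * C)) / eps < n%:R.
  by near: n; exact: nbhs_infty_gtr.
have nR0 : 0 < n%:R :> R by rewrite ltr0n.
(* A deviation above [delta] forces at least [s] vertices without a tree-like
   neighbourhood. *)
pose s : R := delta / (2 * C) * n%:R.
have s0 : 0 < s by rewrite mulr_gt0 // divr_gt0 // mulr_gt0.
rewrite sub0r normrN ger0_norm; last by rewrite divr_ge0.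
apply: (@le_lt_trans _ _ (K%:R / s)); last first.
  have A0 : 0 < delta / (2 * C) by rewrite divr_gt0 // mulr_gt0.
  move: nbig; rewrite ltr_pdivrMr // ltr_pdivrMr // ltr_pdivrMr // => nbig.
  by have -> : eps * s = n%:R * eps * (delta / (2 * C)) by rewrite /s; ring.
apply: (@random_regular_markov _ _ _ _
  (fun G => #|[set v | `[< ~ locally_tree G d k v >]]|)) => //; last first.
  exact: sum_not_locally_tree.
move=> G reg; set bad := #|_| => dev.
have gap (t : R) : 0 < t <= lambda ->
    (tree_bounds d t k).2 - (tree_bounds d t k).1 <= D * alpha ^+ k.
  move=> /andP[t0 tl]; apply: tree_bounds_gap => //; first by rewrite t0.
  by move=> z z0; apply: contr; rewrite ?(ltW t0).
have close := log_partition_close n0 reg l0 x0 fx gap.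
have := lt_le_trans dev close; rewrite -/C -/bad mulrDr => h.
have {}h : delta / 2 < C * (bad%:R / n%:R).
  move: h hk; set u := C * (_ / _); set w := C * _.
  lra.
have C2 : 0 < 2 * C by lra.
rewrite /s -ler_pdivlMr // ler_pdivrMr //.
lra.
Unshelve. all: by end_near.
Qed.

Lemma fixed_pointP (R : realType) (d : nat) (lambda x : R) :
  0 <= lambda -> 0 < x ->
  fixed_point_eq d.+1 lambda x <-> x + lambda * x ^+ d.+1 = 1.
Proof.
move=> l0 x0; rewrite /fixed_point_eq subn1 /= exprS.
have den : 0 < 1 + lambda * x ^+ d by rewrite ltr_pwDl // mulr_ge0 // exprn_ge0 // ltW.
have -> : x + lambda * (x * x ^+ d) = x * (1 + lambda * x ^+ d) by ring.
have nz := lt0r_neq0 den.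
by split=> h; [rewrite {1}h divfK | apply: (mulIf nz); rewrite divfK // h].
Qed.

Lemma fixed_point_unique (R : realType) (d : nat) (lambda x y : R) :
  0 <= lambda -> 0 < x -> 0 < y ->
  x + lambda * x ^+ d.+1 = 1 -> y + lambda * y ^+ d.+1 = 1 -> x = y.
Proof.
wlog xy : x y / x <= y.
  by move=> H l0 x0 y0 fx fy; case: (leP x y) => [|/ltW] xy;
    [|apply/esym]; apply: H.
move=> l0 x0 y0 fx fy; apply/eqP; rewrite eq_le xy /=.
have : lambda * x ^+ d.+1 <= lambda * y ^+ d.+1.
  by rewrite ler_wpM2l // lerXn2r // nnegrE ltW.
lra.
Qed.

Lemma fixed_point_exists (R : realType) (d : nat) (lambda : R) :
  0 <= lambda -> exists2 x : R, 0 < x & x + lambda * x ^+ d.+1 = 1.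
Proof.
move=> l0; pose p : {poly R} := 'X + lambda *: 'X^(d.+1) - 1.
have pE y : p.[y] = y + lambda * y ^+ d.+1 - 1 by rewrite !hornerE.
have [x] : exists2 x, x \in `[0, 1] & root p x.
  apply: poly_ivt => //; rewrite !pE expr0n expr1n /=; lra.
rewrite in_itv /= => /andP[x0 x1] /rootP; rewrite pE => fx.
have fx' : x + lambda * x ^+ d.+1 = 1 by lra.
exists x => //; rewrite lt_neqAle x0 andbT; apply/eqP => x0'.
by move: fx'; rewrite -x0' expr0n mulr0 addr0 => /eqP; rewrite eq_sym oner_eq0.
Qed.

Lemma bethe_densityE (R : realType) (r : nat) (x : R) : 0 < x -> x < 2 ->
  ln (x `^ (- (r%:R / 2)) * (2 - x) `^ (- ((r%:R - 2) / 2))) = bethe_density r x.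
Proof.
move=> x0 x2; rewrite lnM ?posrE ?powR_gt0 ?subr_gt0 // !ln_powR.
by rewrite /bethe_density; ring.
Qed.

(** The critical activities for [d.+1 = 2, 3, 4, 5] are infinity, 4, 27/16 and
    256/243, all above 1; the next one is below 1. *)
Lemma critical_activity1 (R : realType) (d : nat) : (0 < d)%N -> (d <= 4)%N ->
  ((1 : R)%:E < critical_activity R d.+1)%E.
Proof.
case: d => [|[|[|[|[|//]]]]] // _ _; rewrite /critical_activity //=; first by rewrite ltry.
all: by rewrite lte_fin subn1 /= ltr_pdivlMr ?mul1r; lra.
Qed.

(** * Numerical values *)

Definition growth_constant (R : realType) (r : nat) (x : R) : R :=
  x `^ (- (r%:R / 2)) * (2 - x) `^ (- ((r%:R - 2) / 2)).

Lemma powR_half_sqr (R : realType) (m : nat) (y : R) : 0 <= y ->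
  (y `^ (- (m%:R / 2))) ^+ 2 = (y ^+ m)^-1.
Proof.
move=> y0; rewrite -powR_mulrn ?powR_ge0 // -powRrM mulNr divfK ?pnatr_eq0 //.
by rewrite powRN powR_mulrn.
Qed.

Lemma growth_constant_sqr (R : realType) (m : nat) (x : R) : 0 <= x <= 2 ->
  growth_constant m.+2 x ^+ 2 = (x ^+ m.+2 * (2 - x) ^+ m)^-1.
Proof.
move=> /andP[x0 x2]; rewrite /growth_constant exprMn powR_half_sqr //.
have -> : m.+2%:R - 2 = m%:R :> R by rewrite -natr1 -natr1; ring.
by rewrite powR_half_sqr ?subr_ge0 // [RHS]invfM.
Qed.

(** Since [x + x^(m+2)] is increasing, [a] and [b] enclose [x].  The square of the
    constant is the inverse of [x^(m+2) (2-x)^m], which leaves inequalities between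
    rational numbers to check. *)
Lemma growth_constant_bounds (R : realType) (m : nat) (x a b lo hi : R) :
  0 < x -> x + x ^+ m.+2 = 1 ->
  0 < a -> 0 < b < 2 -> 0 < lo -> 0 < hi ->
  a + a ^+ m.+2 <= 1 -> 1 <= b + b ^+ m.+2 ->
  b ^+ m.+2 * (2 - a) ^+ m * lo ^+ 2 <= 1 ->
  1 <= a ^+ m.+2 * (2 - b) ^+ m * hi ^+ 2 ->
  lo <= growth_constant m.+2 x <= hi.
Proof.
move=> x0 fx a0 /andP[b0 b2] lo0 hi0 fa fb Plo Phi.
have ax : a <= x.
  rewrite leNgt; apply/negP => xa.
  have : x ^+ m.+2 < a ^+ m.+2 by rewrite ltrXn2r // ?nnegrE ltW.
  lra.
have xb : x <= b.
  rewrite leNgt; apply/negP => bx.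
  have : b ^+ m.+2 < x ^+ m.+2 by rewrite ltrXn2r // ?nnegrE ltW.
  lra.
have x2 : x < 2 by exact: le_lt_trans b2.
have c0 : 0 < growth_constant m.+2 x by rewrite mulr_gt0 // powR_gt0 // subr_gt0.
have P0 : 0 < x ^+ m.+2 * (2 - x) ^+ m by rewrite mulr_gt0 // exprn_gt0 // subr_gt0.
have sq : growth_constant m.+2 x ^+ 2 = (x ^+ m.+2 * (2 - x) ^+ m)^-1.
  by apply: growth_constant_sqr; rewrite !ltW.
have Pb : x ^+ m.+2 * (2 - x) ^+ m <= b ^+ m.+2 * (2 - a) ^+ m.
  apply: ler_pM; rewrite ?exprn_ge0 ?subr_ge0 ?(ltW x0) ?(ltW x2) //.
    by rewrite lerXn2r ?nnegrE ?(ltW x0) ?(le_trans (ltW x0)).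
  by rewrite lerXn2r ?nnegrE ?subr_ge0 ?(ltW x2) ?lerB // (le_trans ax) // ltW.
have Pa : a ^+ m.+2 * (2 - b) ^+ m <= x ^+ m.+2 * (2 - x) ^+ m.
  apply: ler_pM; rewrite ?exprn_ge0 ?subr_ge0 ?(ltW a0) ?(ltW b2) //.
    by rewrite lerXn2r ?nnegrE ?(ltW x0) ?(ltW a0).
  by rewrite lerXn2r ?nnegrE ?subr_ge0 ?(ltW x2) ?(ltW b2) ?lerB.
apply/andP; split.
  rewrite -(@ler_pXn2r _ 2) ?nnegrE ?(ltW c0) ?(ltW lo0) // sq.
  rewrite -[leLHS]mulr1 -[leRHS]mul1r ler_pdivlMr // mulr1 mulrC.
  by apply: le_trans Plo; rewrite ler_wpM2r // exprn_ge0 // ltW.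
rewrite -(@ler_pXn2r _ 2) ?nnegrE ?(ltW c0) ?(ltW hi0) // sq.
rewrite -[leLHS]mul1r ler_pdivrMr // mulrC.
by apply: le_trans Phi _; rewrite ler_wpM2r // exprn_ge0 // ltW.
Qed.

Lemma cvg_whp_growth_constant (R : realType) (d : nat) (lambda x : R) :
  (0 < d)%N -> 0 < lambda -> (lambda%:E < critical_activity R d.+1)%E ->
  0 < x -> x + lambda * x ^+ d.+1 = 1 ->
  cvg_whp d.+1 (log_partition_density lambda) (ln (growth_constant d.+1 x)).
Proof.
move=> d0 l0 crit x0 fx; rewrite /growth_constant bethe_densityE //.
  exact: cvg_whp_bethe.
have : 0 <= lambda * x ^+ d.+1 by rewrite mulr_ge0 ?exprn_ge0 // ltW.
lra.
Qed.

(** The bound on [m] is where the activity 1 stops being subcritical; [a] and [b]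
    are rational approximations of the fixed point. *)
Lemma cvg_whp_approx (R : realType) (m : nat) (a b c0 eps : R) :
  (m <= 3)%N -> 0 < a -> 0 < b < 2 -> 0 < eps < c0 ->
  a + a ^+ m.+2 <= 1 -> 1 <= b + b ^+ m.+2 ->
  b ^+ m.+2 * (2 - a) ^+ m * (c0 - eps) ^+ 2 <= 1 ->
  1 <= a ^+ m.+2 * (2 - b) ^+ m * (c0 + eps) ^+ 2 ->
  exists2 c : R, cvg_whp m.+2 (log_partition_density 1) (ln c) & `|c - c0| <= eps.
Proof.
move=> m3 a0 b02 /andP[eps0 epsc] fa fb Plo Phi.
have [x x0 fx] := @fixed_point_exists R m.+1 1 ler01.
exists (growth_constant m.+2 x).
  by apply: cvg_whp_growth_constant => //; apply: critical_activity1.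
have lo0 : 0 < c0 - eps by rewrite subr_gt0.
have hi0 : 0 < c0 + eps by rewrite addr_gt0 // (lt_trans eps0).
rewrite ler_distl.
by apply: (growth_constant_bounds x0 _ a0 b02) => //; rewrite -[X in _ + X]mul1r.
Qed.

Theorem theorem5 (R : realType) :
  (forall (r : nat) (lambda : R),
     (2 <= r)%N -> 0 < lambda -> (lambda%:E < critical_activity R r)%E ->
     (exists! x : R, 0 < x /\ fixed_point_eq r lambda x) /\
     (forall x : R, 0 < x -> fixed_point_eq r lambda x ->
        cvg_whp r (log_partition_density lambda)
          (ln (x `^ (- (r%:R / 2)) * (2 - x) `^ (- ((r%:R - 2) / 2)))))) /\
  (exists c2 c3 c4 c5 : R,
     (cvg_whp 2 (log_partition_density 1) (ln c2) /\
      cvg_whp 3 (log_partition_density 1) (ln c3) /\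
      cvg_whp 4 (log_partition_density 1) (ln c4) /\
      cvg_whp 5 (log_partition_density 1) (ln c5)) /\
     (`|c2 - 1618 / 1000| <= 1 / 1000 /\
      `|c3 - 1545 / 1000| <= 1 / 1000 /\
      `|c4 - 1494 / 1000| <= 1 / 1000 /\
      `|c5 - 1453 / 1000| <= 1 / 1000)).
Proof.
split=> [[//|[//|d]] lambda _ l0 crit|].
  split.
    have [x x0 fx] := fixed_point_exists d.+1 (ltW l0).
    exists x; split; first by split=> //; apply/fixed_pointP => //; exact: ltW.
    move=> y [y0 /(fixed_pointP _ (ltW l0) y0) fy].
    exact: fixed_point_unique (ltW l0) x0 y0 fx fy.
  move=> x x0 /(fixed_pointP _ (ltW l0) x0) fx.
  exact: cvg_whp_growth_constant.
(* Fractions just below and just above the four fixed points, chosen with small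
   denominators. *)
have [c2 cvg2 c2P] : exists2 c : R,
    cvg_whp 2 (log_partition_density 1) (ln c) & `|c - 1618 / 1000| <= 1 / 1000.
  by apply: (@cvg_whp_approx R 0 (55 / 89) (34 / 55)); [|clear; lra..].
have [c3 cvg3 c3P] : exists2 c : R,
    cvg_whp 3 (log_partition_density 1) (ln c) & `|c - 1545 / 1000| <= 1 / 1000.
  by apply: (@cvg_whp_approx R 1 (73 / 107) (58 / 85)); [|clear; lra..].
have [c4 cvg4 c4P] : exists2 c : R,
    cvg_whp 4 (log_partition_density 1) (ln c) & `|c - 1494 / 1000| <= 1 / 1000.
  by apply: (@cvg_whp_approx R 2 (71 / 98) (50 / 69)); [|clear; lra..].
have [c5 cvg5 c5P] : exists2 c : R,
    cvg_whp 5 (log_partition_density 1) (ln c) & `|c - 1453 / 1000| <= 1 / 1000.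
  by apply: (@cvg_whp_approx R 3 (117 / 155) (77 / 102)); [|clear; lra..].
by exists c2, c3, c4, c5.
Qed.
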